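(* Let $k\ge1$ be an integer. Assume that $f^*$ is $k$ times continuously differentiable with $\int_0^{2\pi}|{f^*}^{(k)}(t)|^2\,dt<\infty$. Suppose moreover that $f^*$ is not constant, that $a_j^*\ne0$ for all $j=1,\dots,J$, that $\sum_{l\in\mathbb Z}|l||c_l(f^* )|<\infty$ and that $m_n^4/n=o(1)$. Then there exists a constant $C$ such that, for large $m_n$, $$\sup_{t\in\mathbb R}|\hat f_n(t)-f^*(t)|=O_{\mathbb P}\Big(\frac1{m_n^{k-1/2}}+\frac{m_n}{\sqrt n}\Big),$$ $$\int_0^{2\pi}\mathbb E\big(\hat f_n(t)-f^*(t)\big)^2dt\le C\Big(\frac1{m_n^{2k}}+\frac{m_n}{n}\Big).$$ Consequently, for $m_n\sim n^{1/(2k+1)}$, the mean integrated squared error of $\hat f_n$ satisfies $\mathrm{MISE}_{f^*}(\hat f_n)=\int_0^{2\pi}\mathbb E(\hat f_n(t)-f^*(t))^2dt=O(n^{-2k/(2k+1)})$.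
   Context: Setting. Fix an integer $J\ge 2$ and $\upsilon_{\max}>0$; $n$ ranges over odd positive integers and $t_i=2\pi(i-1)/n$, $i=1,\dots,n$. $\mathcal F_0$ is the set of real continuous $2\pi$-periodic functions $f$ with $\int_0^{2\pi}f(t)\,dt=0$, and $c_l(f)=\int_0^{2\pi}f(t)e^{-ilt}\frac{dt}{2\pi}$. $\mathcal A_0$ is the set of $\beta=(\theta,a,\upsilon)\in[0,2\pi]^J\times\mathbb R^J\times[-\upsilon_{\max},\upsilon_{\max}]^J$ with $\theta_1=0$, $\sum_{j=1}^Ja_j^2=J$, $a_1>0$. The true parameters are $\beta^*=(\theta^*,a^*,\upsilon^* )\in\mathcal A_0$, $\sigma^*>0$, $f^*\in\mathcal F_0$. One observes $$Y_{i,j}=a_j^*f^*(t_i-\theta_j^* )+\upsilon_j^*+\sigma^*\varepsilon_{i,j},\quad i=1,\dots,n,\ j=1,\dots,J,$$ with $\varepsilon_{i,j}$ independent standard Gaussian. $(m_n)$ is a nondecreasing sequence of positive integers with $2m_n<n$ and $m_n\to\infty$. Estimators. For $\beta=(\theta,a,\upsilon)\in\mathcal A_0$ and $1\le|l|\le m_n$ put $$\hat c_l(\beta)=\Big(n\sum_{j=1}^Ja_j^2\Big)^{-1}\sum_{j=1}^Ja_j\sum_{i=1}^n(Y_{i,j}-\upsilon_j)e^{-il(t_i-\theta_j)},\qquad M_n(\beta)=\frac1{nJ}\sum_{j=1}^J\sum_{i=1}^n(Y_{i,j}-\upsilon_j)^2-\sum_{1\le|l|\le m_n}|\hat c_l(\beta)|^2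 .$$ $\hat\beta_n=\arg\min_{\beta\in\mathcal A_0}M_n(\beta)$, and the estimator of the common shape $f^*$ is $\hat f_n(t)=\sum_{1\le|l|\le m_n}\hat c_l(\hat\beta_n)e^{ilt}$. $X_n=O_{\mathbb P}(r_n)$ means that $X_n/r_n$ is bounded in probability. *)

(* Defs.v *)
From HB Require Import structures.
From mathcomp Require Export all_boot all_order all_algebra.
From mathcomp Require Export complex.
From mathcomp Require Export all_classical all_reals all_analysis.

Set Implicit Arguments.
Unset Strict Implicit.
Unset Printing Implicit Defensive.

Export Order.TTheory GRing.Theory Num.Theory.
Export numFieldNormedType.Exports.
Export ComplexField.Normc.

Local Open Scope classical_set_scope.
Local Open Scope ring_scope.
Local Open Scope complex_scope.

(* n tends to infinity along the odd integers *)
Definition odd_oo : set_system nat := within [set n : nat | odd n] \oo.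

Section shape.
Variable R : realType.

Definition expi (x : R) : R[i] := cos x +i* sin x.

Definition integralC (D : set R) (g : R -> R[i]) : R[i] :=
  (\int[lebesgue_measure]_(t in D) complex.Re (g t)) +i*
  (\int[lebesgue_measure]_(t in D) complex.Im (g t)).

Definition fourier_coef (f : R -> R) (l : int) : R[i] :=
  integralC `[0, 2 * pi]
    (fun t => (f t)%:C * expi (- (l%:~R * t)) / (2 * pi)%:C).

Definition shape_space : set (R -> R) :=
  [set f | [/\ continuous f, periodic f (2 * pi) &
               \int[lebesgue_measure]_(t in `[0, 2 * pi]) f t = 0]].

Definition Ck (k : nat) (f : R -> R) : Prop :=
  (forall j, (j < k)%N -> forall x, derivable (derive1n j f) x 1) /\
  (forall j, (j <= k)%N -> continuous (derive1n j f)).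

Record param (J : nat) :=
  Param { theta : 'I_J -> R ; ampl : 'I_J -> R ; level : 'I_J -> R }.

Definition param_space (J : nat) (vmax : R) : set (param J) :=
  [set b | (forall j, 0 <= theta b j <= 2 * pi) /\
           (forall j, - vmax <= level b j <= vmax) /\
           (\sum_j ampl b j ^+ 2 = J%:R) /\
           (forall j : 'I_J, j = 0%N :> nat ->
              theta b j = 0 /\ 0 < ampl b j)].

(* t_i = 2 pi (i - 1) / n, with i ranging over 0 .. n - 1 instead of 1 .. n *)
Definition design (n : nat) (i : 'I_n) : R := 2 * pi * i%:R / n%:R.

Definition observations (n J : nat) (b : param J) (s : R) (f : R -> R)
    (e : 'I_n -> 'I_J -> R) : 'M[R]_(n, J) :=
  \matrix_(i, j) (ampl b j * f (design i - theta b j) + level b j + s * e i j).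

Definition sum_freq (V : nmodType) (m : nat) (F : int -> V) : V :=
  \sum_(1 <= l < m.+1) (F l%:Z + F (- l%:Z)).

Section estimators.
Variables (n J m : nat) (y : 'M[R]_(n, J)).

Definition chat (b : param J) (l : int) : R[i] :=
  ((n%:R * \sum_j ampl b j ^+ 2)^-1)%:C *
  \sum_j (ampl b j)%:C * \sum_i (y i j - level b j)%:C *
                           expi (- (l%:~R * (design i - theta b j))).

Definition contrast (b : param J) : R :=
  (n%:R * J%:R)^-1 * (\sum_j \sum_i (y i j - level b j) ^+ 2)
  - sum_freq m (fun l => normc (chat b l) ^+ 2).

Definition fhatC (b : param J) (t : R) : R[i] :=
  sum_freq m (fun l => chat b l * expi (l%:~R * t)).

(* The trigonometric polynomial fhatC is real-valued: see fhatE below. *)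
Definition fhat (b : param J) (t : R) : R := complex.Re (fhatC b t).

Lemma expi_conj x : expi (- x) = (expi x)^*.
Proof. by rewrite /expi cosN sinN. Qed.

Lemma chatN b l : chat b (- l) = (chat b l)^*.
Proof.
rewrite /chat rmorphM /= oppr0; congr (_ * _).
rewrite rmorph_sum; apply: eq_bigr => j _.
rewrite rmorphM /= oppr0; congr (_ * _).
rewrite rmorph_sum; apply: eq_bigr => i _.
by rewrite rmorphM /= oppr0 rmorphN mulNr expi_conj.
Qed.

Lemma fhatE b t : fhatC b t = (fhat b t)%:C.
Proof.
suff h : complex.Im (fhatC b t) = 0.
  by rewrite /fhat; case: (fhatC b t) h => u v /= ->.
rewrite /fhatC /sum_freq raddf_sum big1 // => l _.
rewrite chatN rmorphN mulNr expi_conj -rmorphM.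
by case: (_ * _) => u v /=; rewrite addrN.
Qed.

End estimators.

Definition is_argmin (T : Type) (A : set T) (F : T -> R) (x : T) : Prop :=
  A x /\ forall y, A y -> F x <= F y.

Section random.
Context d (T : measurableType d) (P : probability T R).

(* As some A i may be setT, this entails the product rule for subfamilies. *)
Definition mutually_independent (I : finType) (X : I -> {RV P >-> R}) : Prop :=
  forall A : I -> set R, (forall i, measurable (A i)) ->
    P (\bigcap_i (X i @^-1` A i)) = (\prod_i P (X i @^-1` A i))%E.

Definition standard_gaussian (X : {RV P >-> R}) : Prop :=
  forall A : set R, measurable A ->
    distribution P X A = normal_prob 0 1 A.

Definition gaussian_noise (n J : nat) (e : 'I_n -> 'I_J -> {RV P >-> R}) : Prop :=
  (forall i j, standard_gaussian (e i j)) /\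
  mutually_independent (fun p : 'I_n * 'I_J => e p.1 p.2).

Definition measurable_param (J : nat) (b : T -> param J) : Prop :=
  forall j, [/\ measurable_fun setT (fun w => theta (b w) j),
                measurable_fun setT (fun w => ampl (b w) j) &
                measurable_fun setT (fun w => level (b w) j)].

(* X_n = O_P(r_n), for a sequence indexed by the odd integers n >= 3 *)
Definition bigOP (X : nat -> T -> \bar R) (r : nat -> R) : Prop :=
  forall eps : R, 0 < eps -> exists K : R,
    forall n, odd n -> (2 < n)%N ->
      (P [set w | K%:E < `|X n w * ((r n)^-1)%:E|] <= eps%:E)%E.

Definition sup_dist (g f : R -> R) : \bar R :=
  ereal_sup (range (fun t => `|g t - f t|%:E)).

Definition MISE (g : T -> R -> R) (f : R -> R) : \bar R :=
  (\int[lebesgue_measure]_(t in `[0%R, (2 * pi)%R])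
     'E_P[fun w => ((g w t - f t) ^+ 2)%R])%E.

End random.
End shape.

(* Main.v *)
(* Since the design is equispaced and [2 m < n], minimizing the contrast amounts
   to a least squares fit: [contrast b] is the minimum, over the trigonometric
   polynomials [g] of degree [m] without constant term, of the mean squared
   residual of the model [ampl b j * g (. - theta b j) + level b j], attained at
   [fhat b].  Comparing with the true parameters and the truncated Fourier series
   [f_m] of [fstar], the fitted and the true signals differ, in mean square, by
   at most the truncation bias plus the energy of the noise at the frequencies
   at most [m], whose expectation is of order [m / n].  The difference is then
   transferred to the shape deterministically: the squared amplitudes add up to
   [J], so the norms of [fhat] and [f_m] are close; the first curve is not
   shifted and has a positive amplitude, so [fhat] and [f_m] are close. *)

(* The fitted parameters depend on the noise, so any bound on the cross term between noise and fit
   has to be uniform over the parameters. A shift only rotates each pair of coefficients, so it can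
   be absorbed into the polynomial; what remains of the noise is [noise_energy], which contains no
   parameter. For almost every realization the squared coefficient error is thus at most a constant
   times [m ^- (2 * k)] plus a multiple of [noise_energy], at every odd [n > 2]. Probability enters
   only afterwards: the expectation of [noise_energy] gives the integrated risk, and Markov's
   inequality the uniform rate. The delicate term is the truncation bias on the design. The uniform
   bound, of order [m ^- (2 * k).-1], would lose a factor [m] there, and high frequencies are no
   longer orthogonal on the design. [aliasing_bound] recovers [m ^- (2 * k)] by counting the
   frequencies that coincide modulo [n]. *)
Require Import Defs.
From mathcomp Require Import ring lra zify measurable_realfun.

Set Implicit Arguments.
Unset Strict Implicit.
Unset Printing Implicit Defensive.
Local Open Scope classical_set_scope.
Local Open Scope ring_scope.

(** * Trigonometric polynomials on the design *)

Section trigonometric_polynomials.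
Variable R : realType.
Implicit Types (u v : nat -> R) (t x : R).

(* With [u l - i * v l = 2 * c_l], this is the sum of the [c_l e^{ilt}] over [1 <= |l| <= m]. *)
Definition trig (m : nat) u v t : R :=
  \sum_(1 <= l < m.+1) (u l * cos (l%:R * t) + v l * sin (l%:R * t)).

Definition sqcoef (m : nat) u v : R := \sum_(1 <= l < m.+1) (u l ^+ 2 + v l ^+ 2).

Lemma sqcoef_ge0 m u v : 0 <= sqcoef m u v.
Proof. by apply: sumr_ge0 => l _; rewrite addr_ge0 ?sqr_ge0. Qed.

Lemma trigS m u v t : trig m.+1 u v t =
  trig m u v t + (u m.+1 * cos (m.+1%:R * t) + v m.+1 * sin (m.+1%:R * t)).
Proof. by rewrite /trig big_nat_recr. Qed.

Lemma sqcoefS m u v : sqcoef m.+1 u v = sqcoef m u v + (u m.+1 ^+ 2 + v m.+1 ^+ 2).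
Proof. by rewrite /sqcoef big_nat_recr. Qed.

Lemma trigD m u v u' v' t :
  trig m u v t + trig m u' v' t = trig m (fun l => u l + u' l) (fun l => v l + v' l) t.
Proof. by rewrite /trig -big_split; apply: eq_bigr => l _ /=; ring. Qed.

Lemma trigZ m a u v t :
  a * trig m u v t = trig m (fun l => a * u l) (fun l => a * v l) t.
Proof. by rewrite /trig mulr_sumr; apply: eq_bigr => l _ /=; ring. Qed.

Lemma trigB m u v u' v' t :
  trig m u v t - trig m u' v' t = trig m (fun l => u l - u' l) (fun l => v l - v' l) t.
Proof. by rewrite /trig -sumrB; apply: eq_bigr => l _ /=; ring. Qed.

Definition rotc (h : R) u v l : R := u l * cos (l%:R * h) - v l * sin (l%:R * h).
Definition rots (h : R) u v l : R := u l * sin (l%:R * h) + v l * cos (l%:R * h).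

Lemma trig_shift m u v t h : trig m u v (t - h) = trig m (rotc h u v) (rots h u v) t.
Proof.
rewrite /trig; apply: eq_bigr => l _; rewrite mulrBr cosB sinB /rotc /rots; ring.
Qed.

(** Cauchy-Schwarz over the [m] waves, each at most its amplitude in absolute value. The factor [m]
    is the price of passing from a coefficient error to a uniform error. *)
Lemma trig_sqr_le m u v t : trig m u v t ^+ 2 <= m%:R * sqcoef m u v.
Proof.
elim: m => [|m IH].
  by rewrite /trig big_geq // expr0n mul0r.
rewrite trigS sqcoefS.
set a := trig m u v t in IH *; set s := sqcoef m u v in IH *.
set p := u m.+1; set q := v m.+1; set c := cos _; set d := sin _.
have cd : c ^+ 2 + d ^+ 2 = 1 by rewrite cos2Dsin2.
have h1 : (p * c + q * d) ^+ 2 <= p ^+ 2 + q ^+ 2.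
  have -> : p ^+ 2 + q ^+ 2 = (p * c + q * d) ^+ 2 + (p * d - q * c) ^+ 2.
    by rewrite -[LHS]mulr1 -cd; ring.
  by rewrite lerDl sqr_ge0.
set b := p * c + q * d in h1 *.
case: m @a @s @p @q @c @d cd @b IH h1 => [|m] a s p q c d cd b IH h1.
  have : a = 0 by rewrite /a /trig big_geq.
  have : 0 <= s by apply: sqcoef_ge0.
  by move=> s0 ->; rewrite add0r mul1r; apply: (le_trans h1); rewrite lerDr.
set M : R := m.+1%:R; have M0 : 0 < M by rewrite ltr0n.
have -> : m.+2%:R = M + 1 :> R by rewrite -natr1.
(* Young's inequality with equality at [a = M * b], the weight for which the constant [M] becomes
   exactly [M + 1]; the case of an empty [a] was split off because of [M^-1]. *)
have h2 : (a + b) ^+ 2 <= (1 + M^-1) * a ^+ 2 + (M + 1) * b ^+ 2.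
  rewrite -subr_ge0.
  have -> : (1 + M^-1) * a ^+ 2 + (M + 1) * b ^+ 2 - (a + b) ^+ 2
          = M^-1 * (a - M * b) ^+ 2 by field; rewrite gt_eqF.
  by rewrite mulr_ge0 ?sqr_ge0 // invr_ge0 ltW.
apply: (le_trans h2).
have h3 : (1 + M^-1) * a ^+ 2 <= (1 + M^-1) * (M * s).
  by rewrite ler_wpM2l // addr_ge0 // invr_ge0 ltW.
have e : (1 + M^-1) * (M * s) = (M + 1) * s by field; rewrite gt_eqF.
have h4 : (M + 1) * b ^+ 2 <= (M + 1) * (p ^+ 2 + q ^+ 2).
  by rewrite ler_wpM2l // addr_ge0 // ltW.
by rewrite mulrDr lerD // -e.
Qed.

(** The coefficients are forgotten on purpose: of a polynomial without constant term, only its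
    vanishing mean, on the design or on the circle, will be used. *)
Definition istrig (K : nat) (h : R -> R) := exists u v, forall t, h t = trig K u v t.

Lemma istrig_ext K h h' : h =1 h' -> istrig K h -> istrig K h'.
Proof. by move=> e [u [v hE]]; exists u, v => t; rewrite -e. Qed.

Lemma istrigD K h h' : istrig K h -> istrig K h' -> istrig K (fun t => h t + h' t).
Proof.
move=> [u [v hE]] [u' [v' hE']]; eexists; eexists => t.
by rewrite hE hE' trigD.
Qed.

Lemma istrig0 K : istrig K (fun=> 0).
Proof.
exists (fun=> 0), (fun=> 0) => t; rewrite /trig big1 // => l _; by rewrite !mul0r addr0.
Qed.

Lemma istrig_sum K (r : seq nat) (F : nat -> R -> R) :
  (forall l, l \in r -> istrig K (F l)) -> istrig K (fun t => \sum_(l <- r) F l t).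
Proof.
elim: r => [|a r IH] hF.
  by apply: (istrig_ext _ (istrig0 K)) => t; rewrite big_nil.
apply: (@istrig_ext _ (fun t => F a t + \sum_(l <- r) F l t)).
  by move=> t; rewrite big_cons.
apply: istrigD; first by apply: hF; rewrite mem_head.
by apply: IH => l lr; apply: hF; rewrite in_cons lr orbT.
Qed.

Lemma istrig_wave K l (a b : R) : (0 < l <= K)%N ->
  istrig K (fun t => a * cos (l%:R * t) + b * sin (l%:R * t)).
Proof.
move=> /andP[l0 lK]; exists (fun i => (i == l)%:R * a), (fun i => (i == l)%:R * b) => t.
rewrite /trig (bigD1_seq l) ?iota_uniq ?mem_index_iota ?ltnS ?l0 //=.
rewrite eqxx !mul1r big1 ?addr0 // => i /negPf ->; by rewrite !mul0r addr0.
Qed.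

Lemma wave_mul (a b p q p' q' : R) :
  2 * (p * cos a + q * sin a) * (p' * cos b + q' * sin b) =
  ((p * p' - q * q') * cos (b + a) + (p * q' + q * p') * sin (b + a)) +
  ((p * p' + q * q') * cos (b - a) + (p * q' - q * p') * sin (b - a)).
Proof. rewrite cosD sinD cosB sinB; ring. Qed.

(** Common source of the discrete and the continuous Parseval identities: the square is its mean
    plus waves of positive frequency at most [2 * m]. Keeping the bound [K] fixed spares a change of
    degree in the induction. *)
Lemma trig_sqr m K u v : (2 * m <= K)%N ->
  istrig K (fun t => trig m u v t ^+ 2 - 2^-1 * sqcoef m u v).
Proof.
elim: m => [|m IH] mK.
  apply: istrig_ext (istrig0 K) => t.
  by rewrite /trig /sqcoef !big_geq // expr0n mulr0 subr0.
have h0 := IH ltac:(lia).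
pose w l t := u l * cos (l%:R * t) + v l * sin (l%:R * t).
have h1 : istrig K (fun t => \sum_(1 <= l < m.+1) 2 * w l t * w m.+1 t).
  apply: istrig_sum => l; rewrite mem_index_iota => /andP[l1 l2].
  apply: istrig_ext.
    by move=> t; symmetry; apply: wave_mul.
  (* Since [l <= m], the sum and the difference of the two frequencies are both positive: cross
     terms add nothing to the mean. *)
  have hp : (0 < m.+1 + l <= K)%N by lia.
  have hm : (0 < m.+1 - l <= K)%N by lia.
  apply: istrigD; [apply: istrig_ext (istrig_wave _ _ hp) | apply: istrig_ext (istrig_wave _ _ hm)] => t.
    by rewrite natrD mulrDl.
  by rewrite natrB; [rewrite mulrBl|lia].
have h2 : istrig K (fun t => (u m.+1 ^+ 2 - v m.+1 ^+ 2) / 2 * cos ((2 * m.+1)%:R * t)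
    + u m.+1 * v m.+1 * sin ((2 * m.+1)%:R * t)).
  by apply: istrig_wave; lia.
apply: istrig_ext (istrigD (istrigD h0 h1) h2) => t.
rewrite trigS sqcoefS -mulr_suml -mulr_sumr.
have -> : (2 * m.+1)%:R * t = (m.+1%:R * t) *+ 2 by rewrite natrM -mulr_natl; ring.
rewrite cos_mulr2n sin_mulr2n.
have -> : \sum_(1 <= l < m.+1) w l t = trig m u v t by [].
rewrite /w; set c := cos _; set s := sin _.
have : s ^+ 2 = 1 - c ^+ 2 by rewrite /s sin2cos2.
set T := trig _ _ _ _; set S := sqcoef _ _ _; set p := u _; set q := v _ => hs.
rewrite [RHS](_ : _ = T ^+ 2 - 2^-1 * S + 2 * T * (p * c + q * s)
  + (p ^+ 2 * c ^+ 2 + 2 * p * q * (c * s) + q ^+ 2 * s ^+ 2) - 2^-1 * (p ^+ 2 + q ^+ 2)).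
  by rewrite hs; field.
by field.
Qed.

End trigonometric_polynomials.

(** * Orthogonality and aliasing on the equispaced design *)

Section design.
Variable R : realType.
Implicit Types (u v : nat -> R) (t x : R).

Lemma cosD2pin (x : R) k : cos (x + 2 * pi * k%:R) = cos x.
Proof.
elim: k => [|k IH]; first by rewrite mulr0 addr0.
have -> : x + 2 * pi * k.+1%:R = (x + 2 * pi * k%:R) + pi *+ 2.
  by rewrite -natr1 -mulr_natl; ring.
by rewrite cosD2pi.
Qed.

Lemma sinD2pin (x : R) k : sin (x + 2 * pi * k%:R) = sin x.
Proof.
by rewrite -!cosBpihalf -[RHS](cosD2pin _ k); congr cos; ring.
Qed.

(** The factor [2 * sin (h / 2)] turns each cosine into a difference of two sines half a step apart,
    and the sum telescopes. *)
Lemma sum_cos_step (n : nat) (h phi : R) :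
  (\sum_(i < n) cos (i%:R * h + phi)) * (2 * sin (h / 2)) =
  sin (n%:R * h - h / 2 + phi) - sin (- (h / 2) + phi).
Proof.
elim: n => [|n IH]; first by rewrite big_ord0 !mul0r sub0r subrr.
rewrite big_ord_recr /= mulrDl IH.
have -> : n.+1%:R * h - h / 2 + phi = (n%:R * h + phi) + h / 2.
  by rewrite -natr1; field.
have -> : n%:R * h - h / 2 + phi = (n%:R * h + phi) - h / 2 by ring.
by rewrite (sinD (_ + phi) (h / 2)) (sinB (_ + phi)); ring.
Qed.

(* A geometric sum over the n-th roots of unity, in real form. *)
Lemma sum_cos_design (n l : nat) (phi : R) : ~~ (n %| l)%N ->
  \sum_(i < n) cos (l%:R * design R i + phi) = 0.
Proof.
case: n => [|n] nl; first by rewrite big_ord0.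
(* On the design [l] may be replaced by its residue [r]; then [h / 2] lies strictly between [0] and
   [pi], where the sine cannot vanish. *)
pose r := (l %% n.+1)%N; pose q := (l %/ n.+1)%N.
have r0 : (0 < r)%N by rewrite lt0n; apply: contra nl.
have rn : (r < n.+1)%N by rewrite ltn_mod.
have n0 : n.+1%:R != 0 :> R by rewrite pnatr_eq0.
pose h : R := 2 * pi * r%:R / n.+1%:R.
have E (i : 'I_n.+1) : cos (l%:R * design R i + phi) = cos (i%:R * h + phi).
  rewrite (divn_eq l n.+1) -/q -/r -(cosD2pin (i%:R * h + phi) (q * i)); congr cos.
  by rewrite /design /h natrD !natrM; field.
rewrite (eq_bigr _ (fun i _ => E i)).
have hs : 0 < sin (h / 2).
  have p0 := @pi_gt0 R.
  have -> : h / 2 = pi * (r%:R / n.+1%:R) by rewrite /h; field.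
  apply: sin_gt0_pi; rewrite mulr_gt0 ?divr_gt0 ?ltr0n //=.
  by rewrite gtr_pMr // ltr_pdivrMr ?ltr0n // mul1r ltr_nat.
have := sum_cos_step n.+1 h phi.
have -> : n.+1%:R * h - h / 2 + phi = - (h / 2) + phi + 2 * pi * r%:R.
  by rewrite /h; field.
rewrite sinD2pin subrr => /eqP; rewrite mulf_eq0 => /orP[/eqP //|].
by rewrite mulf_eq0 pnatr_eq0 /= gt_eqF.
Qed.

Lemma sum_sin_design (n l : nat) (phi : R) : ~~ (n %| l)%N ->
  \sum_(i < n) sin (l%:R * design R i + phi) = 0.
Proof.
move=> nl; rewrite -[RHS](sum_cos_design (phi - pi / 2) nl).
by apply: eq_bigr => i _; rewrite addrA cosBpihalf.
Qed.

Lemma sum_trig_design (n K : nat) u v : (K < n)%N ->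
  \sum_(i < n) trig K u v (design R i) = 0.
Proof.
move=> Kn; rewrite /trig exchange_big /= big_nat big1 // => l /andP[l1 lK].
have nl : ~~ (n %| l)%N by apply/negP => /dvdn_leq; lia.
rewrite big_split /= -!mulr_sumr.
have -> : \sum_(i < n) cos (l%:R * design R i) = 0.
  by rewrite -[RHS](sum_cos_design 0 nl); apply: eq_bigr => i _; rewrite addr0.
have -> : \sum_(i < n) sin (l%:R * design R i) = 0.
  by rewrite -[RHS](sum_sin_design 0 nl); apply: eq_bigr => i _; rewrite addr0.
by rewrite !mulr0 addr0.
Qed.

(** By [trig_sqr] all nonconstant waves have frequency at most [2 * m < n], so they sum to zero on
    the design. The constant [c] makes room for the difference between two levels. *)
Lemma discrete_parseval (n m : nat) (c : R) u v : (2 * m < n)%N ->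
  \sum_(i < n) (c + trig m u v (design R i)) ^+ 2
    = n%:R * (c ^+ 2 + 2^-1 * sqcoef m u v).
Proof.
move=> mn; have [U [V H]] := trig_sqr u v (leqnn (2 * m)).
set k0 := c ^+ 2 + 2^-1 * sqcoef m u v.
have E (i : 'I_n) : (c + trig m u v (design R i)) ^+ 2
   = k0 + ((2 * c) * trig m u v (design R i) + trig (2 * m) U V (design R i)).
  by rewrite -H /k0; ring.
clearbody k0.
rewrite (eq_bigr _ (fun i _ => E i)) big_split /= big_split /= -mulr_sumr.
rewrite !sum_trig_design ?mulr0 ?addr0 //; last by lia.
by rewrite sumr_const card_ord -[LHS]mulr_natl.
Qed.

Lemma count_residue (n r a : nat) : (0 < n)%N ->
  (\sum_(a <= l < a + n) (l == r %[mod n]) = 1)%N.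
Proof.
move=> n0; elim: a => [|a IH].
  rewrite add0n (bigD1_seq (r %% n)%N) ?iota_uniq ?mem_index_iota ?ltn_mod //=.
  rewrite modn_mod eqxx big_nat_cond big1 ?addn0 // => l /andP[/andP[_ ln] lr].
  by rewrite (modn_small ln) (negPf lr).
rewrite addSn big_nat_recr /=; last by lia.
move: IH; rewrite (big_ltn (m := a)); last by lia.
by rewrite modnDr addnC.
Qed.

(** Each block of [n] consecutive integers meets the residue class once, and in the block numbered
    [q] from zero [l] exceeds [m + q * n >= (q + 1) * m]. The term [2 / Q.+1] makes the induction
    close, since [2 / x - 2 / (x + 1) >= x ^- 2] for [x >= 1]. *)
Lemma sum_residue_inv_sqr (n m r Q : nat) : (0 < m <= n)%N ->
  \sum_(m.+1 <= l < (m + Q * n).+1) ((l == r %[mod n])%:R * (l%:R ^- 2)) <=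
   (3 - 2 / Q.+1%:R) / m%:R ^+ 2 :> R.
Proof.
move=> /andP[m0 mn].
have M0 : 0 < m%:R :> R by rewrite ltr0n.
elim: Q => [|Q IH].
  by rewrite mul0n addn0 big_geq // divr1 divr_ge0 // ?sqr_ge0 //; lra.
have le1 : (m.+1 <= (m + Q * n).+1)%N by lia.
have le2 : ((m + Q * n).+1 <= (m + Q.+1 * n).+1)%N by rewrite mulSn; lia.
rewrite (big_cat_nat le1 le2) /=.
have h : \sum_((m + Q * n).+1 <= l < (m + Q.+1 * n).+1) ((l == r %[mod n])%:R * (l%:R ^- 2))
   <= (Q.+1%:R * m%:R) ^- 2 :> R.
  apply: (@le_trans _ _ (\sum_((m + Q * n).+1 <= l < (m + Q.+1 * n).+1)
     ((l == r %[mod n])%:R * (Q.+1%:R * m%:R) ^- 2))).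
    rewrite big_nat [leRHS]big_nat; apply: ler_sum => l /andP[l1 _].
    rewrite ler_wpM2l // lef_pV2 ?posrE ?exprn_gt0 ?mulr_gt0 ?ltr0n //; last by lia.
    rewrite lerXn2r ?nnegrE ?mulr_ge0 ?ler0n // -natrM ler_nat mulSn.
    by apply: leq_trans (ltnW l1); rewrite leq_add2l leq_mul2l mn orbT.
  rewrite -mulr_suml -natr_sum.
  have -> : ((m + Q.+1 * n).+1 = (m + Q * n).+1 + n)%N by rewrite mulSn; lia.
  by rewrite count_residue ?mul1r //; lia.
apply: (le_trans (lerD IH h)).
rewrite [X in _ + X](_ : _ = Q.+1%:R ^- 2 / m%:R ^+ 2) ?exprMn ?[X in X = _]invfM //.
rewrite -mulrDl ler_wpM2r ?invr_ge0 ?sqr_ge0 //.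
set x : R := Q.+1%:R; have x0 : 0 < x by rewrite ltr0n.
have -> : Q.+2%:R = x + 1 :> R by rewrite -natr1.
have x1 : 1 <= x by rewrite ler1n.
rewrite -subr_ge0 (_ : _ - _ = (x - 1) / (x ^+ 2 * (x + 1))); last first.
  by field; rewrite !gt_eqF //; lra.
by rewrite divr_ge0 ?subr_ge0 // mulr_ge0 ?sqr_ge0 //; lra.
Qed.

(* The conjugate polynomial is added so that only the differences of frequencies
   survive in the double sum, which is then controlled by a Schur test with
   weights [l ^ k]. *)
Lemma aliasing_bound (n m k Q : nat) (h : R) u v :
  (0 < m <= n)%N -> (0 < k)%N ->
  \sum_(i < n) (\sum_(m.+1 <= l < (m + Q * n).+1)
     (u l * cos (l%:R * (design R i - h)) + v l * sin (l%:R * (design R i - h)))) ^+ 2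
  <= n%:R * (3 / m%:R ^+ (2 * k)) *
     \sum_(m.+1 <= l < (m + Q * n).+1) l%:R ^+ (2 * k) * (u l ^+ 2 + v l ^+ 2).
Proof.
move=> mn k0; set N := (m + Q * n).+1.
have n0 : (0 < n)%N by lia.
have M0 : 0 < m%:R :> R by rewrite ltr0n; lia.
pose x (i : 'I_n) := design R i - h.
pose w (i : 'I_n) l := u l * cos (l%:R * x i) + v l * sin (l%:R * x i).
pose z (i : 'I_n) l := u l * sin (l%:R * x i) - v l * cos (l%:R * x i).
pose rho l := u l ^+ 2 + v l ^+ 2.
have rho0 l : 0 <= rho l by rewrite addr_ge0 ?sqr_ge0.
(* The entry vanishes unless the two frequencies agree modulo [n]. The cases with a zero frequency
   are set aside for the divisions below; the range starts at [m.+1], so they do not occur. *)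
have gram l l' : \sum_(i < n) (w i l * w i l' + z i l * z i l') <=
    n%:R * ((l' == l %[mod n])%:R * (2^-1 *
      (l%:R ^+ (2 * k) * rho l * (l'%:R ^- (2 * k)) +
       l'%:R ^+ (2 * k) * rho l' * (l%:R ^- (2 * k))))) \/ l = 0%N \/ l' = 0%N.
  case: (posnP l) => [->|l0]; first by right; left.
  case: (posnP l') => [->|l0']; first by right; right.
  left.
  wlog ll : l l' l0 l0' / (l' <= l)%N.
    move=> H; case: (leqP l' l) => ll; first exact: H.
    have := H l' l l0' l0 (ltnW ll); rewrite eq_sym [X in _ <= _ * (_ * (_ * X)) -> _]addrC.
    by under eq_bigr do rewrite mulrC [X in _ + X]mulrC.
  have E (i : 'I_n) : w i l * w i l' + z i l * z i l' =
      (u l * u l' + v l * v l') * cos ((l - l')%:R * design R i + - ((l - l')%:R * h))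
      + (v l * u l' - u l * v l') * sin ((l - l')%:R * design R i + - ((l - l')%:R * h)).
    have -> : (l - l')%:R * design R i + - ((l - l')%:R * h) = l%:R * x i - l'%:R * x i.
      by rewrite natrB // /x; ring.
    by rewrite cosB sinB /w /z; ring.
  rewrite (eq_bigr _ (fun i _ => E i)) big_split /= -!mulr_sumr (eq_sym (l' %% n)%N) eqn_mod_dvd //.
  case: (boolP (n %| l - l')%N) => nl; last first.
    by rewrite sum_cos_design // sum_sin_design // !mulr0 addr0 mul0r mulr0.
  rewrite mul1r.
  have L0 : 0 < l%:R ^+ (2 * k) :> R by rewrite exprn_gt0 ?ltr0n.
  have L0' : 0 < l'%:R ^+ (2 * k) :> R by rewrite exprn_gt0 ?ltr0n.
  rewrite !mulr_sumr -big_split /=; set X := 2^-1 * _.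
  have -> : n%:R * X = \sum_(i < n) X by rewrite sumr_const card_ord mulr_natl.
  rewrite /X; apply: ler_sum => i _; rewrite -E; set a := l%:R ^+ _; set b := l'%:R ^+ _.
  have hw j : w i j ^+ 2 + z i j ^+ 2 = rho j.
    rewrite /rho -[RHS]mulr1 -(cos2Dsin2 (j%:R * x i)) /w /z; ring.
  (* Weighted arithmetic-geometric mean inequality: with [a = l ^ (2 * k)] and [b = l' ^ (2 * k)],
     the gap is a sum of squares divided by [2 * a * b]. *)
  rewrite -!hw -subr_ge0 (_ : _ - _ = 2^-1 * (a * b)^-1 * (
    (a * w i l - b * w i l') ^+ 2 + (a * z i l - b * z i l') ^+ 2
    )); last by rewrite /a /b; field; rewrite !gt_eqF.
  by rewrite mulr_ge0 ?addr_ge0 ?sqr_ge0 // mulr_ge0 ?invr_ge0 // ltW // mulr_gt0.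
pose P (i : 'I_n) := \sum_(m.+1 <= l < N) w i l.
pose S (i : 'I_n) := \sum_(m.+1 <= l < N) z i l.
apply: (@le_trans _ _ (\sum_(i < n) (P i ^+ 2 + S i ^+ 2))).
  by apply: ler_sum => i _; rewrite lerDl sqr_ge0.
have -> : \sum_(i < n) (P i ^+ 2 + S i ^+ 2) =
   \sum_(m.+1 <= l < N) \sum_(m.+1 <= l' < N)
      \sum_(i < n) (w i l * w i l' + z i l * z i l').
  under [RHS]eq_bigr do rewrite exchange_big /=.
  rewrite exchange_big /=; apply: eq_bigr => i _.
  rewrite !expr2 {1}/P {1}/S !mulr_suml -big_split /=; apply: eq_bigr => l _.
  by rewrite /P /S !mulr_sumr -big_split.
pose A l := l%:R ^+ (2 * k) * rho l.
pose B l l' : R := (l' == l %[mod n])%:R * (l'%:R ^- (2 * k)).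
apply: (@le_trans _ _ (\sum_(m.+1 <= l < N) \sum_(m.+1 <= l' < N)
   (n%:R * (2^-1 * (A l * B l l' + A l' * B l' l))))).
  rewrite big_nat [leRHS]big_nat; apply: ler_sum => l /andP[l1 _].
  rewrite big_nat [leRHS]big_nat; apply: ler_sum => l' /andP[l1' _].
  case: (gram l l') => [H|[]]; [|by lia|by lia].
  apply: (le_trans H); rewrite /A /B (eq_sym (l %% n)%N).
  by rewrite ler_wpM2l ?ler0n // le_eqVlt; apply/orP; left; apply/eqP; ring.
under eq_bigr do rewrite -mulr_sumr -mulr_sumr big_split /=.
rewrite -!mulr_sumr big_split /= [X in _ * (_ * (_ + X))]exchange_big /= -mulrA.
rewrite ler_wpM2l ?ler0n // [leLHS](_ : _ = 2^-1 * 2 * \sum_(m.+1 <= l < N)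
    \sum_(m.+1 <= l' < N) A l * B l l'); last by ring.
rewrite mulVf ?mul1r ?pnatr_eq0 // mulr_sumr.
rewrite big_nat [leRHS]big_nat; apply: ler_sum => l /andP[l1 _].
rewrite -mulr_sumr mulrC ler_wpM2r ?mulr_ge0 ?exprn_ge0 ?ler0n //.
(* Two of the [2 * k] inverse powers make the sum over the residue class converge; each of the
   others is bounded by [m^-1]. *)
have e : (2 * k = 2 * k.-1 + 2)%N by lia.
apply: (@le_trans _ _ (m%:R ^- (2 * k.-1) *
    \sum_(m.+1 <= l' < N) ((l' == l %[mod n])%:R * (l'%:R ^- 2)))).
  rewrite mulr_sumr big_nat [leRHS]big_nat; apply: ler_sum => l' /andP[l1' _].
  have L0 : 0 < l'%:R :> R by rewrite ltr0n; lia.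
  rewrite /B mulrCA ler_wpM2l ?ler0n // e exprD [leLHS]invfM.
  rewrite ler_wpM2r ?invr_ge0 ?sqr_ge0 // lef_pV2 ?posrE ?exprn_gt0 //.
  by rewrite lerXn2r ?nnegrE ?ler0n // ler_nat ltnW.
apply: (@le_trans _ _ (m%:R ^- (2 * k.-1) * (3 / m%:R ^+ 2))).
  rewrite ler_wpM2l ?invr_ge0 ?exprn_ge0 ?ler0n //.
  apply: (le_trans (sum_residue_inv_sqr _ _ mn)).
  by rewrite ler_wpM2r ?invr_ge0 ?sqr_ge0 // gerBl divr_ge0.
by rewrite mulrCA e exprD [X in _ <= 3 * X]invfM.
Qed.

End design.

(** * Fourier coefficients of continuous functions *)

Section circle_integral.
Variable R : realType.
Implicit Types (F f g : R -> R) (u v : nat -> R).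

Definition circ_int g : R := \int[lebesgue_measure]_(t in `[0, 2 * pi]) g t.
(** Continuity is asked on one closed period only, because the quotient [G] of [fourier_inversion]
    has a denominator that vanishes outside that period. *)
Definition circ_cont g := {within `[0, 2 * pi], continuous g}.

Lemma twopi_gt0 : 0 < 2 * pi :> R.
Proof. by rewrite mulr_gt0 ?pi_gt0. Qed.

Lemma circ_integrable g : circ_cont g ->
  lebesgue_measure.-integrable `[0, 2 * pi] (EFin \o g).
Proof. by move=> cg; apply: continuous_compact_integrable => //; exact: segment_compact. Qed.

Lemma circ_contT g : continuous g -> circ_cont g.
Proof. exact: continuous_subspaceT. Qed.

Lemma circ_contD f g : circ_cont f -> circ_cont g -> circ_cont (fun t => f t + g t).
Proof. by move=> cf cg x; apply: continuousD; [exact: cf|exact: cg]. Qed.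

Lemma circ_contB f g : circ_cont f -> circ_cont g -> circ_cont (fun t => f t - g t).
Proof. by move=> cf cg x; apply: continuousB; [exact: cf|exact: cg]. Qed.

Lemma circ_contM f g : circ_cont f -> circ_cont g -> circ_cont (fun t => f t * g t).
Proof. by move=> cf cg x; apply: continuousM; [exact: cf|exact: cg]. Qed.

Lemma continuous_mul f g : continuous f -> continuous g -> continuous (fun t => f t * g t).
Proof. by move=> cf cg x; apply: continuousM; [exact: cf|exact: cg]. Qed.

Lemma continuous_add f g : continuous f -> continuous g -> continuous (fun t => f t + g t).
Proof. by move=> cf cg x; apply: continuousD; [exact: cf|exact: cg]. Qed.

Lemma continuous_scale (c : R) f : continuous f -> continuous (fun t => c * f t).
Proof. by move=> cf; apply: continuous_mul => // x; exact: cst_continuous. Qed.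

Lemma circ_contX f n : circ_cont f -> circ_cont (fun t => f t ^+ n).
Proof.
move=> cf; elim: n => [|n IH].
  by apply: circ_contT => x; exact: cst_continuous.
rewrite (_ : (fun _ => _) = (fun t => f t * f t ^+ n)); first exact: circ_contM.
by apply/funext => t; rewrite exprS.
Qed.

Lemma circ_cont_cst (c : R) : circ_cont (fun=> c).
Proof. by apply: circ_contT => x; exact: cst_continuous. Qed.

Lemma circ_contZ c f : circ_cont f -> circ_cont (fun t => c * f t).
Proof. by move=> cf; apply: circ_contM => //; exact: circ_cont_cst. Qed.

Lemma circ_intD f g : circ_cont f -> circ_cont g ->
  circ_int (fun t => f t + g t) = circ_int f + circ_int g.
Proof. by move=> cf cg; apply: RintegralD => //; exact: circ_integrable. Qed.

Lemma circ_intB f g : circ_cont f -> circ_cont g ->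
  circ_int (fun t => f t - g t) = circ_int f - circ_int g.
Proof. by move=> cf cg; apply: RintegralB => //; exact: circ_integrable. Qed.

Lemma circ_intZ c f : circ_cont f ->
  circ_int (fun t => c * f t) = c * circ_int f.
Proof. by move=> cf; apply: RintegralZl => //; exact: circ_integrable. Qed.

Lemma eq_circ_int f g : (forall t, 0 <= t <= 2 * pi -> f t = g t) ->
  circ_int f = circ_int g.
Proof.
by move=> fg; apply: eq_Rintegral => t; rewrite inE /= in_itv /= => /fg.
Qed.

Lemma circ_int_cst c : circ_int (fun=> c) = 2 * pi * c.
Proof.
rewrite /circ_int Rintegral_cst //= lebesgue_measure_itv /= lte_fin twopi_gt0.
by rewrite -EFinD /= subr0 mulrC.
Qed.

Lemma circ_int_ge0 f : (forall t, 0 <= f t) -> 0 <= circ_int f.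
Proof. by move=> f0; apply: Rintegral_ge0. Qed.

Lemma le_circ_int f g : circ_cont f -> circ_cont g -> (forall t, 0 <= t <= 2 * pi -> f t <= g t) ->
  circ_int f <= circ_int g.
Proof.
by move=> cf cg fg; apply: le_Rintegral => //; exact: circ_integrable.
Qed.

Lemma circ_cont_sum (r : seq nat) (F : nat -> R -> R) : (forall l, circ_cont (F l)) ->
  circ_cont (fun t => \sum_(l <- r) F l t).
Proof.
move=> cF; elim: r => [|a r IH].
  rewrite (_ : (fun _ => _) = fun=> 0); first exact: circ_cont_cst.
  by apply/funext => t; rewrite big_nil.
rewrite (_ : (fun _ => _) = (fun t => F a t + \sum_(l <- r) F l t)).
  exact: circ_contD.
by apply/funext => t; rewrite big_cons.
Qed.

Lemma circ_int_sum (r : seq nat) (F : nat -> R -> R) : (forall l, circ_cont (F l)) ->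
  circ_int (fun t => \sum_(l <- r) F l t) = \sum_(l <- r) circ_int (F l).
Proof.
move=> cF; elim: r => [|a r IH].
  rewrite big_nil (@eq_circ_int _ (fun=> 0)) ?circ_int_cst ?mulr0 // => t _.
  by rewrite big_nil.
rewrite big_cons -IH -circ_intD //; last exact: circ_cont_sum.
by apply: eq_circ_int => t _; rewrite big_cons.
Qed.

Lemma circ_int_derive F f : (forall x : R, is_derive x 1 F (f x)) -> continuous f ->
  circ_int f = F (2 * pi) - F 0.
Proof.
move=> Ff cf; rewrite /circ_int /Rintegral.
have cF : continuous F.
  move=> x; apply/differentiable_continuous/derivable1_diffP.
  by have [] := Ff x.
rewrite (@continuous_FTC2 _ f F) ?twopi_gt0 //.
- exact: continuous_subspaceT.
- split; first by move=> x _; have [] := Ff x.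
  + by apply: cvg_at_right_filter; exact: cF.
  + by apply: cvg_at_left_filter; exact: cF.
- by move=> x _; rewrite derive1E; have [_ ->] := Ff x.
Qed.

Lemma continuous_cosn (l : nat) (h : R) : continuous (fun t : R => cos (l%:R * (t - h))).
Proof.
move=> t; apply: continuous_comp; last exact: continuous_cos.
apply: cvgM; first exact: cvg_cst.
by apply: cvgB; [exact: cvg_id|exact: cvg_cst].
Qed.

Lemma continuous_sinn (l : nat) (h : R) : continuous (fun t : R => sin (l%:R * (t - h))).
Proof.
move=> t; apply: continuous_comp; last exact: continuous_sin.
apply: cvgM; first exact: cvg_cst.
by apply: cvgB; [exact: cvg_id|exact: cvg_cst].
Qed.

Lemma circ_cos (l : nat) (h : R) : circ_cont (fun t => cos (l%:R * (t - h))).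
Proof. exact/circ_contT/continuous_cosn. Qed.

Lemma circ_sin (l : nat) (h : R) : circ_cont (fun t => sin (l%:R * (t - h))).
Proof. exact/circ_contT/continuous_sinn. Qed.

Lemma circ_cos0 (l : nat) : circ_cont (fun t => cos (l%:R * t)).
Proof. by have := @circ_cos l 0; under eq_fun do rewrite subr0. Qed.

Lemma circ_sin0 (l : nat) : circ_cont (fun t => sin (l%:R * t)).
Proof. by have := @circ_sin l 0; under eq_fun do rewrite subr0. Qed.

Lemma is_derive_cosn (l : nat) (x : R) :
  is_derive x 1 (fun t : R => cos (l%:R * t)) (- (l%:R * sin (l%:R * x))).
Proof.
have h : is_derive x 1 (fun t : R => l%:R * t) l%:R.
  apply/is_derive1_caratheodory; exists (fun=> l%:R); split => // [z|].
    by rewrite mulrBr.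
  exact: cst_continuous.
apply: (is_derive_eq (is_derive1_comp (is_derive_cos (l%:R * x)) h)).
by rewrite mulNr mulrC.
Qed.

Lemma is_derive_sinn (l : nat) (x : R) :
  is_derive x 1 (fun t : R => sin (l%:R * t)) (l%:R * cos (l%:R * x)).
Proof.
have h : is_derive x 1 (fun t : R => l%:R * t) l%:R.
  apply/is_derive1_caratheodory; exists (fun=> l%:R); split => // [z|].
    by rewrite mulrBr.
  exact: cst_continuous.
apply: (is_derive_eq (is_derive1_comp (is_derive_sin (l%:R * x)) h)).
by rewrite mulrC.
Qed.

Lemma cosn2pi (l : nat) : cos (l%:R * (2 * pi)) = 1 :> R.
Proof. by have := cosD2pin (0 : R) l; rewrite add0r cos0 mulrC. Qed.

Lemma sinn2pi (l : nat) : sin (l%:R * (2 * pi)) = 0 :> R.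
Proof. by have := sinD2pin (0 : R) l; rewrite add0r sin0 mulrC. Qed.

Lemma circ_int_parts (l : nat) F f : (forall x : R, is_derive x 1 F (f x)) ->
  continuous f -> F (2 * pi) = F 0 ->
  circ_int (fun t => f t * cos (l%:R * t)) = l%:R * circ_int (fun t => F t * sin (l%:R * t)) /\
  circ_int (fun t => f t * sin (l%:R * t)) = - l%:R * circ_int (fun t => F t * cos (l%:R * t)).
Proof.
move=> Ff cf F2.
have cF : continuous F.
  move=> x; apply/differentiable_continuous/derivable1_diffP.
  by have [] := Ff x.
have cc := @continuous_cosn l 0; have cs := @continuous_sinn l 0.
have cc' : continuous (fun t : R => cos (l%:R * t)) by move: cc; under eq_fun do rewrite subr0.
have cs' : continuous (fun t : R => sin (l%:R * t)) by move: cs; under eq_fun do rewrite subr0.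
have c1 := continuous_mul cf cc'; have c2 := continuous_mul cF cs'.
have c3 := continuous_mul cf cs'; have c4 := continuous_mul cF cc'.
split.
- have H (x : R) : is_derive x 1 (fun t => F t * cos (l%:R * t))
     (f x * cos (l%:R * x) + (- l%:R) * (F x * sin (l%:R * x))).
    apply: (is_derive_eq (is_deriveM (Ff x) (is_derive_cosn l x))).
    by rewrite /GRing.scale /=; ring.
  have := circ_int_derive H (continuous_add c1 (continuous_scale c2)).
  rewrite F2 cosn2pi mulr0 cos0 subrr circ_intD ?circ_intZ.
  + by rewrite mulNr => /eqP; rewrite subr_eq0 => /eqP.
  + exact: circ_contT.
  + exact: circ_contT.
  + exact/circ_contZ/circ_contT.
- have H (x : R) : is_derive x 1 (fun t => F t * sin (l%:R * t))
     (f x * sin (l%:R * x) + l%:R * (F x * cos (l%:R * x))).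
    apply: (is_derive_eq (is_deriveM (Ff x) (is_derive_sinn l x))).
    by rewrite /GRing.scale /=; ring.
  have := circ_int_derive H (continuous_add c3 (continuous_scale c4)).
  rewrite F2 sinn2pi !mulr0 sin0 mulr0 subrr circ_intD ?circ_intZ.
  + by rewrite mulNr => /eqP; rewrite addr_eq0 => /eqP.
  + exact: circ_contT.
  + exact: circ_contT.
  + exact/circ_contZ/circ_contT.
Qed.

(** Integration by parts against the constant [1], whose derivative is zero. *)
Lemma circ_int_cos_sin (l : nat) : (0 < l)%N ->
  circ_int (fun t => cos (l%:R * t)) = 0 /\ circ_int (fun t => sin (l%:R * t)) = 0.
Proof.
move=> l0; have L0 : l%:R != 0 :> R by rewrite pnatr_eq0 -lt0n.
have h0 (x : R) : is_derive x 1 (fun=> 1 : R) 0 by exact: is_derive_cst.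
have c0 : continuous ((fun=> 0) : R -> R) by move=> x; exact: cst_continuous.
have [] := circ_int_parts l h0 c0 erefl.
have z (w : R -> R) : circ_int (fun t => 0 * w t) = 0.
  by rewrite (@eq_circ_int _ (fun=> 0)) ?circ_int_cst ?mulr0 // => t _; rewrite mul0r.
have o (w : R -> R) : circ_int (fun t => 1 * w t) = circ_int w.
  by apply: eq_circ_int => t _; rewrite mul1r.
rewrite !z !o => /esym/eqP + /esym/eqP; rewrite !mulf_eq0 oppr_eq0 (negPf L0) /=.
by move=> /eqP -> /eqP ->.
Qed.

Lemma circ_trig m u v : circ_cont (trig m u v).
Proof.
apply: circ_cont_sum => l; apply: circ_contD; apply: circ_contZ.
  exact: circ_cos0.
exact: circ_sin0.
Qed.

Lemma circ_int_trig m u v : circ_int (trig m u v) = 0.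
Proof.
rewrite circ_int_sum; last first.
  by move=> l; apply: circ_contD; apply: circ_contZ; [exact: circ_cos0|exact: circ_sin0].
rewrite big_nat big1 // => l /andP[l0 _]; have [hc hs] := circ_int_cos_sin l0.
rewrite circ_intD ?circ_intZ ?hc ?hs ?mulr0 ?addr0 //;
 do ?apply: circ_contZ; (exact: circ_cos0 || exact: circ_sin0).
Qed.

Lemma circ_parseval m u v :
  circ_int (fun t => trig m u v t ^+ 2) = pi * sqcoef m u v.
Proof.
have [U [V H]] := trig_sqr u v (leqnn (2 * m)).
rewrite (@eq_circ_int _ (fun t => 2^-1 * sqcoef m u v + trig (2 * m) U V t)); last first.
  by move=> t _; rewrite -H; ring.
rewrite circ_intD ?circ_int_cst ?circ_int_trig ?addr0.
- by field.
- exact: circ_cont_cst.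
- exact: circ_trig.
Qed.

(** With the factor [pi^-1], [trig m (fcos g) (fsin g)] is the Fourier partial sum of [g] without
    its constant term. *)
Definition fcos g l : R := pi^-1 * circ_int (fun t => g t * cos (l%:R * t)).
Definition fsin g l : R := pi^-1 * circ_int (fun t => g t * sin (l%:R * t)).

Lemma circ_int_trigM g m u v : circ_cont g ->
  circ_int (fun t => g t * trig m u v t) =
  pi * \sum_(1 <= l < m.+1) (u l * fcos g l + v l * fsin g l).
Proof.
move=> cg.
have c1 l : circ_cont (fun t => u l * (g t * cos (l%:R * t))).
  by apply/circ_contZ/circ_contM => //; exact: circ_cos0.
have c2 l : circ_cont (fun t => v l * (g t * sin (l%:R * t))).
  by apply/circ_contZ/circ_contM => //; exact: circ_sin0.
rewrite (@eq_circ_int _ (fun t => \sum_(1 <= l < m.+1)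
   (u l * (g t * cos (l%:R * t)) + v l * (g t * sin (l%:R * t))))); last first.
  by move=> t _; rewrite /trig mulr_sumr; apply: eq_bigr => l _; ring.
rewrite circ_int_sum; last by move=> l; exact: circ_contD.
rewrite mulr_sumr; apply: eq_bigr => l _.
rewrite (circ_intD (c1 l) (c2 l)) !circ_intZ /fcos /fsin.
- have p0 : (pi : R) != 0 by rewrite gt_eqF ?pi_gt0.
  by move: (pi : R) p0 => p p0; field.
- by apply: circ_contM => //; exact: circ_sin0.
- by apply: circ_contM => //; exact: circ_cos0.
Qed.

Lemma bessel g m : circ_cont g ->
  pi * sqcoef m (fcos g) (fsin g) <= circ_int (fun t => g t ^+ 2).
Proof.
move=> cg; set T := trig m (fcos g) (fsin g).
have cT : circ_cont T by exact: circ_trig.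
have h : 0 <= circ_int (fun t => (g t - T t) ^+ 2).
  by apply: circ_int_ge0 => t; exact: sqr_ge0.
rewrite (@eq_circ_int _ (fun t => g t ^+ 2 - 2 * (g t * T t) + T t ^+ 2)) in h; last first.
  by move=> t _; ring.
have cgT := circ_contM cg cT.
have c1 := circ_contX (n := 2) cg; have c2 := circ_contZ (c := 2) cgT.
rewrite (circ_intD (circ_contB c1 c2) (circ_contX (n := 2) cT)) in h.
rewrite (circ_intB c1 c2) (circ_intZ _ cgT) in h.
rewrite circ_parseval circ_int_trigM // in h.
have e : \sum_(1 <= l < m.+1) (fcos g l * fcos g l + fsin g l * fsin g l) = sqcoef m (fcos g) (fsin g).
  by apply: eq_bigr => l _; rewrite !expr2.
by rewrite e in h; lra.
Qed.

(** The squares are the terms of a series whose partial sums are bounded by Bessel's inequality. *)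
Lemma riemann_lebesgue g : circ_cont g ->
  (fun l => fcos g l ^+ 2 + fsin g l ^+ 2) @ \oo --> (0 : R).
Proof.
move=> cg; pose a l := fcos g l ^+ 2 + fsin g l ^+ 2.
have a0 l : 0 <= a l by rewrite addr_ge0 ?sqr_ge0.
apply: cvg_series_cvg_0; apply: nondecreasing_is_cvgn.
  by apply: nondecreasing_series => n _ _; exact: a0.
(* [series] starts at index 0 and [sqcoef] at 1, hence the extra term [a 0]. *)
exists (a 0%N + pi^-1 * circ_int (fun t => g t ^+ 2)) => _ [n _ <-].
have := bessel n cg; rewrite /series /= => h.
case: n h => [|n] h.
  rewrite big_geq // addr_ge0 //.
  by rewrite mulr_ge0 ?invr_ge0 ?pi_ge0 // circ_int_ge0 // => t; exact: sqr_ge0.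
rewrite big_ltn // lerD2l -ler_pdivrMl ?invr_gt0 ?pi_gt0 // invrK.
apply: le_trans h; rewrite sqcoefS mulrDr lerDl.
by rewrite mulr_ge0 ?pi_ge0 ?addr_ge0 ?sqr_ge0.
Qed.

End circle_integral.

(** Cauchy-Schwarz through Lagrange's identity: the gap is half the double sum of squares [h]. *)
Lemma sqr_sum_le (R : realFieldType) (I : Type) (r : seq I) (a b : I -> R) :
  (\sum_(i <- r) a i * b i) ^+ 2 <= (\sum_(i <- r) a i ^+ 2) * (\sum_(i <- r) b i ^+ 2).
Proof.
have h : 0 <= \sum_(i <- r) \sum_(j <- r) (a i * b j - a j * b i) ^+ 2.
  by apply: sumr_ge0 => i _; apply: sumr_ge0 => j _; exact: sqr_ge0.
have e : \sum_(i <- r) \sum_(j <- r) (a i * b j - a j * b i) ^+ 2 =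
    (\sum_(i <- r) a i ^+ 2) * (\sum_(i <- r) b i ^+ 2)
  + (\sum_(i <- r) b i ^+ 2) * (\sum_(i <- r) a i ^+ 2)
  + (- 2) * ((\sum_(i <- r) a i * b i) * (\sum_(i <- r) a i * b i)).
  rewrite !big_distrlr /= mulr_sumr -!big_split /=; apply: eq_bigr => i _.
  by rewrite mulr_sumr -!big_split /=; apply: eq_bigr => j _; ring.
by rewrite e in h; rewrite expr2; lra.
Qed.

(** * Decay of the coefficients and pointwise convergence of Fourier series *)

Section fourier_decay.
Variable R : realType.
Implicit Types (F f g : R -> R) (u v : nat -> R).

Lemma sum_inv_sqr_tail (m N : nat) : (0 < m <= N)%N ->
  \sum_(m.+1 <= l < N.+1) l%:R ^- 2 <= m%:R^-1 - N%:R^-1 :> R.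
Proof.
move=> /andP[m0]; elim: N => [|N IH]; first by rewrite leqNgt m0.
rewrite leq_eqVlt => /predU1P[<-|mN]; first by rewrite big_geq // subrr.
rewrite big_nat_recr //=.
have /= h := IH mN; rewrite -lerBrDr; apply: (le_trans h).
have N0 : 0 < N%:R :> R by rewrite ltr0n; lia.
rewrite -natr1; set x : R := N%:R in N0 *; have x0 := N0.
have mn0 : m%:R != 0 :> R by rewrite pnatr_eq0; lia.
have x1 : 0 < x + 1 by rewrite addr_gt0.
have [n0 n1] := (lt0r_neq0 x0, lt0r_neq0 x1).
rewrite -subr_ge0 (_ : _ - _ = (x * (x + 1) ^+ 2)^-1).
  by rewrite invr_ge0 mulr_ge0 ?sqr_ge0 // ltW.
by field; rewrite mn0 n0 n1.
Qed.

(** Cauchy-Schwarz between [l ^ k * w l] and [l ^- k]. The sum of the [l ^- (2 * k)] beyond [m] is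
    at most [m ^- (2 * k).-1]: this is where the exponent [k - 1/2] of the uniform rate comes
    from. *)
Lemma trig_tail_sqr (m N k : nat) u v (B t : R) : (0 < m <= N)%N -> (0 < k)%N ->
  \sum_(1 <= l < N.+1) l%:R ^+ (2 * k) * (u l ^+ 2 + v l ^+ 2) <= B ->
  (trig N u v t - trig m u v t) ^+ 2 <= B / m%:R ^+ (2 * k).-1.
Proof.
move=> mN k0 hB; have /andP[m0 mN'] := mN.
have M0 : 0 < m%:R :> R by rewrite ltr0n.
have le1 : (1 <= m.+1)%N by []; have le2 : (m.+1 <= N.+1)%N by [].
rewrite /trig (big_cat_nat le1 le2) /= addrAC subrr add0r.
pose w l := u l * cos (l%:R * t) + v l * sin (l%:R * t).
have wle l : w l ^+ 2 <= u l ^+ 2 + v l ^+ 2.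
  have -> : u l ^+ 2 + v l ^+ 2 = w l ^+ 2 + (u l * sin (l%:R * t) - v l * cos (l%:R * t)) ^+ 2.
    rewrite /w; have := cos2Dsin2 (l%:R * t); set c := cos _; set s := sin _ => cd.
    by rewrite -[LHS]mulr1 -cd; ring.
  by rewrite lerDl sqr_ge0.
have B0 : 0 <= B.
  apply: le_trans hB; apply: sumr_ge0 => l _.
  by rewrite mulr_ge0 ?exprn_ge0 // addr_ge0 ?sqr_ge0.
have -> : \sum_(m.+1 <= l < N.+1) w l = \sum_(m.+1 <= l < N.+1) (l%:R ^+ k * w l) * l%:R ^- k.
  rewrite big_nat [RHS]big_nat; apply: eq_bigr => l /andP[l1 _].
  by rewrite mulrAC divff ?mul1r // expf_neq0 // pnatr_eq0; lia.
apply: (le_trans (sqr_sum_le _ _ _)); apply: ler_pM.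
- by apply: sumr_ge0 => l _; exact: sqr_ge0.
- by apply: sumr_ge0 => l _; exact: sqr_ge0.
- apply: le_trans hB; rewrite [leRHS](big_cat_nat le1 le2) /= -[leLHS]add0r lerD //.
    by apply: sumr_ge0 => l _; rewrite mulr_ge0 ?exprn_ge0 // addr_ge0 ?sqr_ge0.
  apply: ler_sum => l _; rewrite exprMn -exprM mulnC ler_wpM2l ?exprn_ge0 //.
have e : (2 * k = 2 * k.-1 + 2)%N by lia.
apply: (@le_trans _ _ (m%:R ^- (2 * k.-1) * \sum_(m.+1 <= l < N.+1) l%:R ^- 2)).
  rewrite mulr_sumr big_nat [leRHS]big_nat; apply: ler_sum => l /andP[l1 _].
  have L0 : 0 < l%:R :> R by rewrite ltr0n; lia.
  rewrite exprVn -exprM mulnC e exprD [leLHS]invfM.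
  rewrite ler_wpM2r ?invr_ge0 ?sqr_ge0 // lef_pV2 ?posrE ?exprn_gt0 //.
  by rewrite lerXn2r ?nnegrE ?ler0n // ler_nat ltnW.
have -> : ((2 * k).-1 = 2 * k.-1 + 1)%N by lia.
rewrite exprD [leRHS]invfM ler_wpM2l ?invr_ge0 ?exprn_ge0 // expr1.
by apply: (le_trans (sum_inv_sqr_tail mN)); rewrite gerBl invr_ge0.
Qed.

(** In mean square, Parseval replaces Cauchy-Schwarz, which gains a factor [m] over the pointwise
    bound. *)
Lemma circ_trig_tail (m N k : nat) u v (B : R) : (0 < m <= N)%N ->
  \sum_(1 <= l < N.+1) l%:R ^+ (2 * k) * (u l ^+ 2 + v l ^+ 2) <= B ->
  circ_int (fun t => (trig N u v t - trig m u v t) ^+ 2) <= pi * (B / m%:R ^+ (2 * k)).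
Proof.
move=> /andP[m0 mN] hB.
have M0 : 0 < m%:R :> R by rewrite ltr0n.
have le1 : (1 <= m.+1)%N by []; have le2 : (m.+1 <= N.+1)%N by [].
(* The cutoff rewrites the tail as a polynomial starting at frequency 1, to which Parseval
   applies. *)
pose c l : R := (m < l)%N%:R.
have E t : trig N u v t - trig m u v t = trig N (fun l => c l * u l) (fun l => c l * v l) t.
  rewrite /trig (big_cat_nat le1 le2) /= addrAC subrr add0r [RHS](big_cat_nat le1 le2) /=.
  set S := (X in _ = X + _); have -> : S = 0.
    rewrite /S big_nat big1 // => l /andP[_ l1].
    by rewrite /c ltnNge -ltnS l1 !mul0r addr0.
  rewrite add0r big_nat [RHS]big_nat; apply: eq_bigr => l /andP[l1 _].
  by rewrite /c l1 !mul1r.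
rewrite (@eq_circ_int _ _ (fun t => trig N (fun l => c l * u l) (fun l => c l * v l) t ^+ 2)); last first.
  by move=> t _; rewrite E.
rewrite circ_parseval ler_wpM2l ?pi_ge0 // ler_pdivlMr ?exprn_gt0 //.
apply: le_trans hB; rewrite /sqcoef mulr_suml big_nat [leRHS]big_nat.
apply: ler_sum => l /andP[l0 _].
rewrite !exprMn -mulrDr mulrAC ler_wpM2r ?addr_ge0 ?sqr_ge0 //.
rewrite /c; case: (ltnP m l) => ml; last by rewrite expr0n mul0r exprn_ge0.
by rewrite expr1n mul1r lerXn2r ?nnegrE ?ler0n // ler_nat ltnW.
Qed.

Lemma periodic_derive1 f (a : R) : periodic f a -> periodic (derive1 f) a.
Proof.
move=> pf x; rewrite /derive1; set d := (fun h : R => _); set d' := (fun h : R => _).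
suff -> : d = d' by [].
by apply/funext => h; rewrite /d /d' addrA !pf.
Qed.

Lemma periodic_derive1n f (a : R) j : periodic f a -> periodic (derive1n j f) a.
Proof. by move=> pf; elim: j => [//|j IH]; exact: periodic_derive1. Qed.

Lemma periodicz f (a : R) (z : int) x : periodic f a -> f (x + a * z%:~R) = f x.
Proof.
move=> pf; have H n y : f (y + a * n%:R) = f y.
  elim: n => [|n IH]; first by rewrite mulr0 addr0.
  by rewrite -natr1 mulrDr mulr1 addrA pf.
case: (intP z) => [|n|n]; first by rewrite mulr0 addr0.
  exact: H.
by rewrite mulrNz mulrN -[LHS](H n.+1) subrK.
Qed.

Lemma fourier_derive1 f l : (forall x, derivable f x 1) -> continuous (derive1 f) ->
  periodic f (2 * pi) ->
  fcos (derive1 f) l ^+ 2 + fsin (derive1 f) l ^+ 2 = l%:R ^+ 2 * (fcos f l ^+ 2 + fsin f l ^+ 2).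
Proof.
move=> df cf pf.
have h (x : R) : is_derive x 1 f ((derive1 f) x) by rewrite derive1E; exact/derivableP.
have p2 : f (2 * pi) = f 0 by rewrite -(pf 0) add0r.
by have [h1 h2] := circ_int_parts l h cf p2; rewrite /fcos /fsin h1 h2; ring.
Qed.

(** Bessel's inequality for the derivative of order [k]: by parts, each derivation multiplies the
    squared coefficients at frequency [l] by [l ^ 2]. *)
Lemma fourier_decay f k : Ck k f -> periodic f (2 * pi) ->
  exists2 B : R, 0 <= B & forall N,
    \sum_(1 <= l < N.+1) l%:R ^+ (2 * k) * (fcos f l ^+ 2 + fsin f l ^+ 2) <= B.
Proof.
move=> [df cf] pf.
have E j l : (j <= k)%N -> fcos (derive1n j f) l ^+ 2 + fsin (derive1n j f) l ^+ 2 =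
    l%:R ^+ (2 * j) * (fcos f l ^+ 2 + fsin f l ^+ 2).
  elim: j => [|j IH] jk; first by rewrite muln0 expr0 mul1r.
  rewrite [derive1n _ _]/(derive1 (derive1n j f)) fourier_derive1.
  - by rewrite IH 1?ltnW // mulrA -exprD mulnS.
  - exact: df.
  - exact: (cf j.+1).
  - exact: periodic_derive1n.
have ck : circ_cont (derive1n k f) by apply/circ_contT/cf.
exists (pi^-1 * circ_int (fun t => derive1n k f t ^+ 2)).
  by rewrite mulr_ge0 ?invr_ge0 ?pi_ge0 // circ_int_ge0 // => t; exact: sqr_ge0.
move=> N; have := bessel N ck; rewrite -ler_pdivlMl ?pi_gt0 // => h.
by apply: le_trans h; apply: ler_sum => l _; rewrite E.
Qed.

(** The usual numerator, the sine of [(N + 1/2) * s], is left expanded: only the integer frequency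
    [N] oscillates, and the half angles can be moved into the integrated function. *)
Lemma dirichlet_kernel (N : nat) (s : R) :
  (1 + 2 * \sum_(1 <= l < N.+1) cos (l%:R * s)) * sin (s / 2) =
  sin (N%:R * s) * cos (s / 2) + cos (N%:R * s) * sin (s / 2).
Proof.
elim: N => [|N IH].
  by rewrite big_geq // mulr0 addr0 mul0r sin0 cos0 mul0r add0r.
rewrite big_nat_recr //= mulrDr addrA mulrDl IH -!sinD.
have -> : N%:R * s + s / 2 = N.+1%:R * s - s / 2 by rewrite -natr1; field.
by rewrite (sinD (_ * s) (s / 2)) (sinB (_ * s) (s / 2)); ring.
Qed.

Lemma sin_half_neq0 (s : R) : s != 0 -> - (2 * pi) < s < 2 * pi -> sin (s / 2) != 0.
Proof.
wlog s0 : s / 0 < s.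
  move=> H sn0 /andP[s1 s2]; case: (ltrgt0P s) => s0.
  - by apply: H => //; rewrite s1.
  - have -> : s / 2 = - ((- s) / 2) by rewrite mulNr opprK.
    rewrite sinN oppr_eq0; apply: H; rewrite ?oppr_gt0 ?oppr_eq0 //.
    by rewrite ltrN2 s2 /= ltrNl.
  - by rewrite s0 eqxx in sn0.
move=> _ /andP[_ s2]; rewrite gt_eqF // sin_gt0_pi // divr_gt0 //=.
by rewrite ltr_pdivrMr // mulrC.
Qed.

(** Meant for the remainder of Fourier inversion: the [a]s are four Fourier coefficients at
    frequency [N], and the right side is the quantity that the Riemann-Lebesgue lemma sends to
    zero. *)
Lemma wave_comb_sqr (c s a1 a2 a3 a4 : R) : c ^+ 2 + s ^+ 2 = 1 ->
  (2^-1 * (c * (a2 + a3) + s * (a4 - a1))) ^+ 2 <=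
  a1 ^+ 2 + a2 ^+ 2 + (a3 ^+ 2 + a4 ^+ 2).
Proof.
move=> cs1.
have h1 : (c * (a2 + a3) + s * (a4 - a1)) ^+ 2 <= (a2 + a3) ^+ 2 + (a4 - a1) ^+ 2.
  rewrite -subr_ge0 (_ : _ - _ = (c * (a4 - a1) - s * (a2 + a3)) ^+ 2) ?sqr_ge0 //.
  by rewrite -[X in X - _]mul1r -cs1; ring.
have h2 := sqr_ge0 (a2 - a3); have h3 := sqr_ge0 (a4 + a1).
have [k1 k2 k3 k4] := And4 (sqr_ge0 a1) (sqr_ge0 a2) (sqr_ge0 a3) (sqr_ge0 a4).
rewrite exprMn; set y := (_ + _) ^+ 2 in h1 *; clearbody y.
by rewrite !expr2 in h1 h2 h3 k1 k2 k3 k4 *; lra.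
Qed.

(* Chernoff's argument: the slope quotient turns the Dirichlet integral into
   Fourier coefficients of continuous functions. *)
Lemma fourier_inversion f (x : R) : (forall x, derivable f x 1) -> continuous f ->
  circ_int f = 0 -> 0 < x < 2 * pi ->
  (fun N => trig N (fcos f) (fsin f) x) @ \oo --> f x.
Proof.
move=> df cf f0 /andP[x0 x2].
have := is_derive1_caratheodory f x ((derive1 f) x).
case=> /(_ _) [|hf [hfE hfc _] _]; first by rewrite derive1E; exact/derivableP.
have hh (t : R) : is_derive t 1 (fun t : R => (t - x) / 2) (2^-1).
  apply/is_derive1_caratheodory; exists (fun=> 2^-1); split => // [z|].
    by ring.
  exact: cst_continuous.
have ds := @is_derive1_comp R (@sin R) (fun t => (t - x) / 2) x _ _ (is_derive_sin _) (hh x).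
have [/(_ ds) [hs [hsE hsc hsx]] _] := is_derive1_caratheodory (sin \o (fun t : R => (t - x) / 2)) x (cos ((x - x) / 2) * 2^-1).
have hs0 (t : R) : 0 <= t <= 2 * pi -> hs t != 0.
  move=> /andP[t0 t2]; have [->|tx] := eqVneq t x.
    by rewrite hsx subrr mul0r cos0 mul1r invr_eq0.
  have := hsE t; rewrite /= subrr mul0r sin0 subr0 => e.
  apply/eqP => h0; rewrite h0 mul0r in e.
  have : sin ((t - x) / 2) != 0.
    by apply: sin_half_neq0; rewrite ?subr_eq0 //; apply/andP; split; lra.
  by rewrite e eqxx.
pose c t : R := cos ((t - x) / 2).
(* Off [x], this is [F t] times the cotangent of [(t - x) / 2]. Writing it with the two Caratheodory
   slopes removes the singularity at [x]. *)
pose G t := hf t * c t / hs t.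
pose F t := f t - f x.
have cc : continuous c.
  move=> t; apply: continuous_comp; last exact: continuous_cos.
  by apply: cvgM; [apply: cvgB; [exact: cvg_id|exact: cvg_cst]|exact: cvg_cst].
have cs : continuous (fun t : R => sin ((t - x) / 2)).
  move=> t; apply: continuous_comp; last exact: continuous_sin.
  by apply: cvgM; [apply: cvgB; [exact: cvg_id|exact: cvg_cst]|exact: cvg_cst].
have slope_cont (h k : R -> R) (t : R) : (forall z, k z - k x = h z * (z - x)) ->
    {for x, continuous h} -> continuous k -> {for t, continuous h}.
  move=> hE hx ck; have [->//|tx] := eqVneq t x.
  have tx' : t - x != 0 by rewrite subr_eq0.
  have C : (fun z => (k z - k x) / (z - x)) @ t --> (k t - k x) / (t - x).
    apply: cvgM; first by apply: cvgB; [exact: ck|exact: cvg_cst].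
    by apply: cvgV => //; apply: cvgB; [exact: cvg_id|exact: cvg_cst].
  have ht : (k t - k x) / (t - x) = h t by rewrite hE mulfK.
  rewrite /prop_for /continuous_at -ht; apply: cvg_trans C; apply: near_eq_cvg.
  have B : (fun z => z - x) @ t --> t - x by apply: cvgB; [exact: cvg_id|exact: cvg_cst].
  apply: (filterS _ (cvgr_neq0 _ B tx')) => z zx; rewrite hE mulfK //.
have cG : circ_cont G.
  apply/subspace_continuousP => t /=; rewrite in_itv /= => /hs0 hst.
  apply: cvg_within_filter.
  apply: cvgM; last apply: cvgV => //.
    apply: cvgM; last exact: cc.
    exact: slope_cont hfE hfc cf.
  exact: slope_cont hsE hsc cs.
have cF : circ_cont F by apply/circ_contT => t; apply: cvgB; [exact: cf|exact: cvg_cst].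
have key N : trig N (fcos f) (fsin f) x - f x =
   2^-1 * (cos (N%:R * x) * (fsin G N + fcos F N) + sin (N%:R * x) * (fsin F N - fcos G N)).
  have cl l := @circ_cos R l x.
  pose D t := 1 + 2 * \sum_(1 <= l < N.+1) cos (l%:R * (t - x)).
  have cS : circ_cont (fun t => \sum_(1 <= l < N.+1) cos (l%:R * (t - x))) by exact: circ_cont_sum.
  (* The constant term of the kernel [D] meets [f], of integral zero, and [f x], of integral
     [2 * pi * f x]; its cosines reproduce the partial sum at [x]. *)
  have e1 : circ_int (fun t => F t * D t) = 2 * pi * (trig N (fcos f) (fsin f) x - f x).
    pose A1 t := f t * trig N (fun l => cos (l%:R * x)) (fun l => sin (l%:R * x)) t.
    pose A2 := trig N (fun l => cos (l%:R * x)) (fun l => sin (l%:R * x)).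
    have E t : F t * D t = (f t - f x) + (2 * A1 t - (2 * f x) * A2 t).
      rewrite /F /D /A1 /A2 (_ : trig N _ _ t = \sum_(1 <= l < N.+1) cos (l%:R * (t - x))).
        by ring.
      by apply: eq_bigr => l _; rewrite mulrBr cosB; ring.
    have cA2 : circ_cont A2 by exact: circ_trig.
    have cA1 : circ_cont A1 by apply: circ_contM; [exact: circ_contT|exact: circ_trig].
    rewrite (@eq_circ_int _ _ (fun t => (f t - f x) + (2 * A1 t - (2 * f x) * A2 t))) //.
    have cA := circ_contZ (c := 2) cA1; have cA' := circ_contZ (c := 2 * f x) cA2.
    rewrite (circ_intD cF (circ_contB cA cA')) (circ_intB cA cA').
    rewrite (circ_intZ _ cA1) (circ_intZ _ cA2).
    rewrite (circ_intB (circ_contT cf) (circ_cont_cst (c := f x))) circ_int_cst f0.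
    rewrite circ_int_trig circ_int_trigM; last exact: circ_contT.
    rewrite sub0r mulr0 subr0 [trig N (fcos f) _ _](_ : _ =
      \sum_(1 <= l < N.+1) (cos (l%:R * x) * fcos f l + sin (l%:R * x) * fsin f l)).
      by ring.
    by apply: eq_bigr => l _; ring.
  have e2 t : 0 <= t <= 2 * pi -> F t * D t =
     cos (N%:R * x) * (G t * sin (N%:R * t) + F t * cos (N%:R * t))
   + sin (N%:R * x) * (F t * sin (N%:R * t) - G t * cos (N%:R * t)).
    move=> tI; have hst := hs0 t tI.
    have E : F t * D t = G t * sin (N%:R * (t - x)) + F t * cos (N%:R * (t - x)).
      have e := hsE t; rewrite /= subrr mul0r sin0 subr0 in e.
      have [tx|tx] := eqVneq t x.
        by rewrite /F tx !subrr !mul0r mulr0 sin0 mulr0 addr0.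
      have tx' : t - x != 0 by rewrite subr_eq0.
      have s0 : sin ((t - x) / 2) != 0 by rewrite e mulf_neq0.
      have e3 : G t * sin ((t - x) / 2) = F t * c t by rewrite /G /F hfE e; field.
      apply: (mulIf s0); rewrite -mulrA dirichlet_kernel.
      rewrite [RHS](_ : _ = (G t * sin ((t - x) / 2)) * sin (N%:R * (t - x))
          + F t * cos (N%:R * (t - x)) * sin ((t - x) / 2)); last by ring.
      by rewrite e3 /c; ring.
    by rewrite E mulrBr sinB cosB; ring.
  have c1 : circ_cont (fun t => G t * sin (N%:R * t)) by apply: circ_contM => //; exact: circ_sin0.
  have c2 : circ_cont (fun t => F t * cos (N%:R * t)) by apply: circ_contM => //; exact: circ_cos0.
  have c3 : circ_cont (fun t => F t * sin (N%:R * t)) by apply: circ_contM => //; exact: circ_sin0.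
  have c4 : circ_cont (fun t => G t * cos (N%:R * t)) by apply: circ_contM => //; exact: circ_cos0.
  rewrite (eq_circ_int e2) in e1.
  rewrite (circ_intD (circ_contZ (circ_contD c1 c2)) (circ_contZ (circ_contB c3 c4))) in e1.
  rewrite (circ_intZ _ (circ_contD c1 c2)) (circ_intZ _ (circ_contB c3 c4)) in e1.
  rewrite (circ_intD c1 c2) (circ_intB c3 c4) in e1.
  rewrite -/(trig _ _ _ _) in e1 *; rewrite /fsin /fcos -/(fsin f) -/(fcos f).
  have p0 : pi != 0 :> R by rewrite gt_eqF ?pi_gt0.
  apply: (@mulfI _ (2 * pi)); first by rewrite mulf_neq0 // pnatr_eq0.
  by rewrite -e1; move: (pi : R) p0 => p p0; field.
have small : (fun N => (fcos G N ^+ 2 + fsin G N ^+ 2) + (fcos F N ^+ 2 + fsin F N ^+ 2))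
    @ \oo --> (0 : R).
  by rewrite -[X in _ --> X](addr0 0); apply: cvgD; exact: riemann_lebesgue.
apply/cvgrPdist_le => e e0.
have e2 : 0 < e ^+ 2 by rewrite exprn_gt0.
have [N0 _ H] := cvgr_le _ small _ e2; exists N0 => // N /= /H hN.
rewrite distrC key -(ler_pXn2r (n := 2)) ?nnegrE ?normr_ge0 ?(ltW e0) //.
rewrite real_normK ?num_real //; apply: (le_trans _ hN).
exact/wave_comb_sqr/cos2Dsin2.
Qed.

Lemma trig_periodic N u v : periodic (trig N u v) (2 * pi).
Proof.
move=> t; apply: eq_bigr => l _.
have -> : l%:R * (t + 2 * pi) = l%:R * t + 2 * pi * l%:R by ring.
by rewrite cosD2pin sinD2pin.
Qed.

Lemma continuous_trig N u v : continuous (trig N u v).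
Proof.
elim: N => [|N IH].
  rewrite (_ : trig _ _ _ = fun=> 0); first by move=> x; exact: cst_continuous.
  by apply/funext => t; rewrite /trig big_geq.
rewrite (_ : trig _ _ _ = fun t => trig N u v t +
  (u N.+1 * cos (N.+1%:R * t) + v N.+1 * sin (N.+1%:R * t))); last first.
  by apply/funext => t; rewrite trigS.
have cc := @continuous_cosn R N.+1 0; have cs := @continuous_sinn R N.+1 0.
apply: continuous_add => //; apply: continuous_add; apply: continuous_scale.
  by move: cc; under eq_fun do rewrite subr0.
by move: cs; under eq_fun do rewrite subr0.
Qed.

(** Inversion is available inside the period only: the tail bound passes to the limit there, extends
    to [0] by continuity from the right, then to the line by periodicity. *)
Lemma trig_tail_limit f (k m : nat) (B t : R) : (0 < m)%N -> (0 < k)%N ->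
  Ck k f -> periodic f (2 * pi) -> circ_int f = 0 ->
  (forall N, \sum_(1 <= l < N.+1) l%:R ^+ (2 * k) * (fcos f l ^+ 2 + fsin f l ^+ 2) <= B) ->
  (f t - trig m (fcos f) (fsin f) t) ^+ 2 <= B / m%:R ^+ (2 * k).-1.
Proof.
move=> m0 k0 [df cf] pf f0 hB; set C := B / _.
pose h t := (f t - trig m (fcos f) (fsin f) t) ^+ 2.
have df1 x : derivable f x 1 := df 0%N k0 x.
have cf0 : continuous f := cf 0%N (leq0n k).
have ct := @continuous_trig m (fcos f) (fsin f).
have ch : continuous h.
  rewrite (_ : h = fun x => (f x - trig m (fcos f) (fsin f) x) * (f x - trig m (fcos f) (fsin f) x)).
    by move=> x; apply: cvgM; apply: cvgB; (exact: cf0 || exact: ct).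
  by apply/funext => x; rewrite /h expr2.
have inner x : 0 < x < 2 * pi -> h x <= C.
  move=> xI; have inv := fourier_inversion df1 cf0 f0 xI.
  have c1 : (fun N => trig N (fcos f) (fsin f) x - trig m (fcos f) (fsin f) x) @ \oo -->
      f x - trig m (fcos f) (fsin f) x by apply: cvgB => //; exact: cvg_cst.
  rewrite /h expr2; apply: (cvgr_to_le (cvgM c1 c1)).
  exists m => // N /= mN; rewrite -[leLHS]expr2; apply: trig_tail_sqr => //.
  by rewrite m0 mN.
have h0 : h 0 <= C.
  have c0 : h x @[x --> 0^'+] --> h 0 by apply: cvg_at_right_filter; exact: ch.
  apply: (cvgr_to_le c0).
  near=> x; apply: inner; apply/andP; split; first by near: x; exact: nbhs_right_gt.
  by near: x; apply: nbhs_right_lt; exact: twopi_gt0.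
have ph : periodic h (2 * pi) by move=> x; rewrite /h pf trig_periodic.
have p0 := twopi_gt0 R.
pose z := Num.floor (t / (2 * pi)).
rewrite -/(h t) (_ : t = (t - 2 * pi * z%:~R) + 2 * pi * z%:~R); last by rewrite subrK.
rewrite periodicz //.
have /andP[z1 z2] := floor_itv (t / (2 * pi)); rewrite -/z in z1 z2.
rewrite ler_pdivlMr // mulrC in z1; rewrite ltr_pdivrMr // intrD mulrDl mul1r in z2.
have : 0 <= t - 2 * pi * z%:~R by rewrite subr_ge0.
rewrite le_eqVlt => /predU1P[<-//|t0]; apply: inner; rewrite t0 /=.
by rewrite ltrBlDr [X in _ < _ + X]mulrC addrC.
Unshelve. all: by end_near. Qed.

End fourier_decay.

(** * Truncation error of the shape: uniform, integrated, and on the design *)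

Section shape_approximation.
Variable R : realType.

Lemma sqrD_le (a b : R) : (a + b) ^+ 2 <= 2 * a ^+ 2 + 2 * b ^+ 2.
Proof.
by have := sqr_ge0 (a - b); rewrite !expr2 => h; lra.
Qed.

(* For the integral, resp. the sum over the design, the frequencies above
   [N = m ^ 2], resp. [N = m + m n], are negligible by the uniform bound. *)
Lemma shape_approx (f : R -> R) k : Ck k f -> (0 < k)%N -> periodic f (2 * pi) ->
  circ_int f = 0 ->
  exists2 B : R, 0 <= B & forall m, (0 < m)%N -> let fm := trig m (fcos f) (fsin f) in
    [/\ forall t, (f t - fm t) ^+ 2 <= B / m%:R ^+ (2 * k).-1,
        circ_int (fun t => (f t - fm t) ^+ 2) <= B / m%:R ^+ (2 * k) &
        forall n (h : R), (m <= n)%N ->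
          \sum_(i < n) (f (design R i - h) - fm (design R i - h)) ^+ 2
            <= n%:R * (B / m%:R ^+ (2 * k))].
Proof.
move=> Cf k0 pf f0; have [B B0 hB] := fourier_decay Cf pf.
set u := fcos f in hB *; set v := fsin f in hB *.
have tail m t : (0 < m)%N -> (f t - trig m u v t) ^+ 2 <= B / m%:R ^+ (2 * k).-1.
  by move=> m0; exact: trig_tail_limit hB.
have p1 : 1 <= pi :> R by have := pi_ge2 R; lra.
(* From [m ^ 2] on, the uniform bound has exponent [2 * (2 * k - 1)] in [m], which is at least
   [2 * k]. *)
have far m N t : (0 < m)%N -> (m * m <= N)%N -> (f t - trig N u v t) ^+ 2 <= B / m%:R ^+ (2 * k).
  move=> m0 mN; have N0 : (0 < N)%N by nia.
  apply: (le_trans (tail N t N0)); rewrite ler_wpM2l //.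
  rewrite lef_pV2 ?posrE ?exprn_gt0 ?ltr0n //.
  apply: (@le_trans _ _ ((m * m)%:R ^+ (2 * k).-1)).
    rewrite natrM -expr2 -exprM ler_weXn2l ?ler1n //; lia.
  by rewrite lerXn2r ?nnegrE ?ler0n // ler_nat.
(* The integral costs [2 * (2 * pi) + 2 * pi = 6 * pi] and the design sum [2 + 2 * 3 = 8]; [8 * pi]
   covers both. *)
pose B' := 8 * pi * B.
have B'0 : 0 <= B' by rewrite !mulr_ge0 ?pi_ge0.
have cf : continuous f by have [_ h] := Cf; exact: (h 0%N).
have cT N := @circ_trig R N u v.
exists B' => // m m0 fm.
have M0 : 0 < m%:R :> R by rewrite ltr0n.
set D := m%:R ^+ (2 * k).
have D0 : 0 < D by rewrite exprn_gt0.
have BD0 : 0 <= B / D by rewrite divr_ge0 // ltW.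
have pBD : B / D <= pi * (B / D) by rewrite ler_peMl.
have eB' : B' / D = 8 * (pi * (B / D)) by rewrite /B'; ring.
split.
- move=> t; apply: (le_trans (tail m t m0)).
  rewrite ler_wpM2r ?invr_ge0 ?exprn_ge0 // /B' ler_peMl //; lra.
- have mN : (0 < m <= m * m)%N by apply/andP; split => //; nia.
  have h1 := circ_trig_tail mN (hB (m * m)%N).
  set N := (m * m)%N in h1 mN.
  have c1 : circ_cont (fun t => (f t - trig N u v t) ^+ 2).
    by apply/circ_contX/circ_contB; [exact: circ_contT|exact: cT].
  have c2 : circ_cont (fun t => (trig N u v t - fm t) ^+ 2).
    by apply/circ_contX/circ_contB; exact: cT.
  have c3 : circ_cont (fun t => (f t - fm t) ^+ 2).
    by apply/circ_contX/circ_contB; [exact: circ_contT|exact: cT].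
  have c4 := circ_contD (circ_contZ (c := 2) c1) (circ_contZ (c := 2) c2).
  apply: (le_trans (le_circ_int c3 c4 _)).
    by move=> t _; rewrite -(subrKA (trig N u v t)); exact: sqrD_le.
  rewrite (circ_intD (circ_contZ (c := 2) c1) (circ_contZ (c := 2) c2)).
  rewrite (circ_intZ _ c1) (circ_intZ _ c2).
  have h2 : circ_int (fun t => (f t - trig N u v t) ^+ 2) <= 2 * pi * (B / D).
    rewrite -circ_int_cst; apply: le_circ_int => //; first exact: circ_cont_cst.
    by move=> t _; exact: far.
  rewrite eB' -/D in h1 *; rewrite -mulrA in h2.
  by move: (circ_int _) (circ_int _) (pi * _) pBD h1 h2 => x y z *; lra.
- move=> n h mn; set N := (m + m * n)%N.
  have mn' : (0 < m <= n)%N by rewrite m0.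
  have h1 := aliasing_bound m h u v mn' k0; rewrite -/N -/D in h1.
  have le1 : (1 <= m.+1)%N by [].
  have le2 : (m.+1 <= N.+1)%N by rewrite /N; lia.
  have E t : trig N u v t - fm t =
      \sum_(m.+1 <= l < N.+1) (u l * cos (l%:R * t) + v l * sin (l%:R * t)).
    by rewrite /fm /trig (big_cat_nat le1 le2) /= addrAC subrr add0r.
  have h3 : \sum_(m.+1 <= l < N.+1) l%:R ^+ (2 * k) * (u l ^+ 2 + v l ^+ 2) <= B.
    apply: le_trans (hB N); rewrite [leRHS](big_cat_nat le1 le2) /= lerDr.
    by apply: sumr_ge0 => l _; rewrite mulr_ge0 ?exprn_ge0 // addr_ge0 ?sqr_ge0.
  have h4 : \sum_(i < n) (trig N u v (design R i - h) - fm (design R i - h)) ^+ 2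
     <= n%:R * (3 * (B / D)).
    under eq_bigr do rewrite E.
    apply: (le_trans h1); rewrite -mulrA ler_wpM2l //.
    rewrite mulrAC -mulrA ler_wpM2l // ler_wpM2r // invr_ge0 ltW //.
  apply: (@le_trans _ _ (\sum_(i < n) (2 * (B / D) +
     2 * (trig N u v (design R i - h) - fm (design R i - h)) ^+ 2))).
    apply: ler_sum => i _; rewrite -(subrKA (trig N u v (design R i - h))).
    apply: (le_trans (sqrD_le _ _)); rewrite lerD2r ler_wpM2l //.
    apply: far => //; rewrite /N (leq_trans _ (leq_addl _ _)) //.
    by rewrite leq_mul2l mn orbT.
  rewrite big_split /= sumr_const card_ord -mulr_sumr -[X in X + _]mulr_natl.
  rewrite eB'; have hn : 0 <= n%:R :> R by [].
  have : n%:R * (B / D) <= n%:R * (pi * (B / D)) by rewrite ler_wpM2l.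
  rewrite [n%:R * (2 * _)]mulrCA [n%:R * (3 * _)]mulrCA in h4 *.
  rewrite [n%:R * (8 * _)]mulrCA.
  have : 0 <= n%:R * (B / D) by rewrite mulr_ge0.
  move: (\sum_(i < n) _) (n%:R * (B / D)) (n%:R * (pi * _)) h4 => x y z *; lra.
Qed.

End shape_approximation.

(** * Gaussian noise *)

Section normal_moments.
Variable R : realType.
Local Notation mu := (@lebesgue_measure R).
Local Notation N01 := (@normal_prob R 0 1).

(** The Radon-Nikodym derivative of the normal law and [normal_pdf] have the same integral over
    every measurable set, so they agree almost everywhere. *)
Lemma ge0_integral_normal (f : R -> \bar R) : (forall x, (0 <= f x)%E) ->
  measurable_fun setT f ->
  (\int[N01]_x f x = \int[mu]_x (f x * (normal_pdf 0 1 x)%:E))%E.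
Proof.
move=> f0 mf; have dom := @normal_prob_dominates R 0 1.
rewrite -(Radon_Nikodym_SigmaFinite.change_of_variables dom f0 measurableT mf).
set g := Radon_Nikodym_SigmaFinite.f _ _.
have ig : mu.-integrable setT g by exact: Radon_Nikodym_SigmaFinite.f_integrable.
have mg := measurable_int _ ig.
have mpdf : measurable_fun setT (fun x : R => (normal_pdf 0 1 x)%:E).
  by apply/measurable_EFinP; exact: measurable_normal_pdf.
apply: ae_eq_integral => //.
- exact: emeasurable_funM.
- exact: emeasurable_funM.
- apply: ae_eqe_mul2l; apply: integral_ae_eq => // E _ mE.
  by rewrite -Radon_Nikodym_SigmaFinite.f_integral.
Qed.

Lemma measurable_sqrE : measurable_fun setT (fun x : R => (x ^+ 2)%:E).
Proof. by apply/measurable_EFinP; exact: exprn_measurable. Qed.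

(** Domination by a multiple of the centred normal density of variance 2: [y <= expR y] at
    [y = x ^ 2 / 4] trades the factor [x ^ 2] for half of the exponent. *)
Lemma normal_second_moment_lty : (\int[N01]_x (x ^+ 2)%:E < +oo)%E.
Proof.
rewrite ge0_integral_normal; last 2 first.
- by move=> x; rewrite lee_fin sqr_ge0.
- exact: measurable_sqrE.
have s2 : Num.sqrt 2 != 0 :> R by rewrite gt_eqF // sqrtr_gt0.
pose c : R := 4 * normal_peak 1 / normal_peak (Num.sqrt 2).
have c0 : 0 <= c by rewrite !mulr_ge0 ?invr_ge0 ?normal_peak_ge0.
have p0 : normal_peak (Num.sqrt 2 : R) != 0 by rewrite gt_eqF ?normal_peak_gt0.
apply: (@le_lt_trans _ _ (\int[mu]_x (c%:E * (normal_pdf 0 (Num.sqrt 2) x)%:E))%E).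
  apply: ge0_le_integral => //.
  - by move=> x _; rewrite -EFinM lee_fin mulr_ge0 ?sqr_ge0 ?normal_pdf_ge0.
  - apply: emeasurable_funM; first exact: measurable_sqrE.
    by apply/measurable_EFinP; exact: measurable_normal_pdf.
  - apply: emeasurable_funM; first exact: measurable_cst.
    by apply/measurable_EFinP; exact: measurable_normal_pdf.
  - move=> x _; rewrite -!EFinM lee_fin !normal_pdfE ?oner_eq0 //.
    rewrite /normal_fun !subr0 expr1n sqr_sqrtr //.
    rewrite mulrCA /c [leRHS](_ : _ = normal_peak 1 * (4 * expR (- x ^+ 2 / (2 *+ 2)))); last first.
      by field.
    rewrite ler_wpM2l ?normal_peak_ge0 //.
    set y := x ^+ 2 / 4.
    have -> : - x ^+ 2 / (2 *+ 2) = - y by rewrite /y; field.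
    have -> : - x ^+ 2 / (1 *+ 2) = - y + - y by rewrite /y; field.
    have hy : y <= expR y by have := expR_ge1Dx y; lra.
    have -> : x ^+ 2 = 4 * y by rewrite /y; field.
    rewrite expRD mulrA ler_pM2r ?expR_gt0 // -mulrA -[leRHS]mulr1 ler_wpM2l //.
    by rewrite expRN -ler_pdivlMr ?invr_gt0 ?expR_gt0 // invrK mul1r.
rewrite ge0_integralZl //.
- by rewrite integral_normal_pdf mule1 ltry.
- by apply/measurable_EFinP; exact: measurable_normal_pdf.
- by move=> x _; rewrite lee_fin normal_pdf_ge0.
Qed.

(** Symmetry of the density under [x -> - x], stated for the positive and negative parts because a
    signed integral is their difference. *)
Lemma normal_mean_parts :
  (\int[N01]_x (Num.max x 0)%:E = \int[N01]_x (Num.max (- x) 0)%:E)%E.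
Proof.
have mx : measurable_fun setT (fun x : R => (Num.max x 0)%:E).
  by apply/measurable_EFinP/measurable_maxr => //; exact: measurable_cst.
have mNx : measurable_fun setT (fun x : R => (Num.max (- x) 0)%:E).
  apply/measurable_EFinP/measurable_maxr; last exact: measurable_cst.
  exact: measurable_funN.
rewrite !ge0_integral_normal //; last 2 first.
- by move=> x; rewrite lee_fin le_max lexx orbT.
- by move=> x; rewrite lee_fin le_max lexx orbT.
under eq_integral do rewrite -EFinM.
under [RHS]eq_integral do rewrite -EFinM.
pose G x : R := Num.max (- x) 0 * normal_pdf 0 1 x.
have cG : continuous G.
  move=> x; apply: cvgM; last exact: continuous_normal_pdf (oner_neq0 _) x.
  by apply: continuous_max; [exact: opp_continuous|exact: cst_continuous].
have even x : normal_pdf 0 1 (- x) = normal_pdf 0 1 x :> R.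
  by rewrite !normal_pdfE ?oner_eq0 // /normal_fun !subr0 sqrrN.
have G0 x : 0 <= G x by rewrite mulr_ge0 ?normal_pdf_ge0 // le_max lexx orbT.
have H : (\int[mu]_(x in `]-oo, (- 0)%R]) (G x)%:E = \int[mu]_(x in `[0%R, +oo[) ((G \o -%R) x)%:E)%E.
  apply: ge0_integration_by_substitutionNy => //.
  exact: continuous_subspaceT.
have -> : (\int[mu]_x (G x)%:E = \int[mu]_(x in `]-oo, (- 0)%R]) (G x)%:E)%E.
  rewrite [RHS]integral_mkcond; apply: eq_integral => x _.
  rewrite patchE; case: ifPn => //; rewrite notin_setE /= in_itv /= oppr0 => /negP.
  by rewrite -ltNge => x0; rewrite /G max_r ?mul0r // oppr_le0 ltW.
rewrite H [RHS]integral_mkcond; apply: eq_integral => x _.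
rewrite patchE /G /= opprK even; case: ifPn => //.
rewrite notin_setE /= in_itv /= andbT => /negP.
by rewrite -ltNge => x0; rewrite max_r ?mul0r // ltW.
Qed.

End normal_moments.

Section gaussian_variables.
Context d (T : measurableType d) (R : realType) (P : probability T R).
Implicit Types X Y : {RV P >-> R}.

Definition second_moment : R := fine (\int[@normal_prob R 0 1]_x (x ^+ 2)%:E).

Lemma second_moment_ge0 : 0 <= second_moment.
Proof. by rewrite fine_ge0 // integral_ge0 // => x _; rewrite lee_fin sqr_ge0. Qed.

(* The normal law lives on the measurable type generated by half-open intervals,
   random variables on the canonical one: [i] below changes the type. *)
Lemma standard_gaussian_integral X (f : R -> \bar R) : standard_gaussian X ->
  measurable_fun setT f -> (forall x, (0 <= f x)%E) ->
  (\int[P]_w f (X w) = \int[@normal_prob R 0 1]_x f x)%E.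
Proof.
move=> gX mf f0; rewrite -(ge0_integral_distribution X mf f0).
pose i : measurableTypeR R -> R := id.
have mi : measurable_fun setT i by exact: measurable_id.
have <- : (\int[pushforward (@normal_prob R 0 1) i]_x f x = \int[@normal_prob R 0 1]_x f x)%E.
  by rewrite ge0_integral_pushforward.
by apply: eq_measure_integral => A mA _; exact: gX.
Qed.

Lemma gaussian_sqr X : standard_gaussian X ->
  (\int[P]_w (X w ^+ 2)%:E = second_moment%:E)%E.
Proof.
move=> gX; rewrite (standard_gaussian_integral (f := fun x => (x ^+ 2)%:E) gX).
- rewrite /second_moment fineK // ge0_fin_numE ?normal_second_moment_lty //.
  by apply: integral_ge0 => x _; rewrite lee_fin sqr_ge0.
- exact: measurable_sqrE.
- by move=> x; rewrite lee_fin sqr_ge0.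
Qed.

Lemma RV_measurable X : measurable_fun setT (X : T -> R).
Proof. exact: measurable_funPT. Qed.

Lemma gaussian_integrable_mul X Y : standard_gaussian X -> standard_gaussian Y ->
  P.-integrable setT (fun w => (X w * Y w)%:E).
Proof.
move=> gX gY; have i2 (Z : {RV P >-> R}) : standard_gaussian Z -> P.-integrable setT (fun w => (Z w ^+ 2)%:E).
  move=> gZ; apply/integrableP; split.
    by apply/measurable_EFinP; apply: measurable_funX; exact: RV_measurable.
  under eq_integral do rewrite gee0_abs ?lee_fin ?sqr_ge0 //.
  by rewrite gaussian_sqr // ltry.
apply: le_integrable (integrableD measurableT (i2 _ gX) (i2 _ gY)) => //.
  by apply/measurable_EFinP; apply: measurable_funM; exact: RV_measurable.
move=> w _; rewrite /= lee_fin [leRHS]ger0_norm ?addr_ge0 ?sqr_ge0 //.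
have h1 := sqr_ge0 (X w - Y w); have h2 := sqr_ge0 (X w + Y w).
have h3 := sqr_ge0 (X w); have h4 := sqr_ge0 (Y w).
by rewrite ler_norml; apply/andP; rewrite !expr2 in h1 h2 h3 h4 *; split; lra.
Qed.

Lemma gaussian_integrable X : standard_gaussian X ->
  P.-integrable setT (fun w => (X w)%:E).
Proof.
move=> gX; have i1 : P.-integrable setT (fun=> 1%:E) by exact: finite_measure_integrable_cst.
apply: le_integrable (integrableD measurableT i1 (gaussian_integrable_mul gX gX)) => //.
  by apply/measurable_EFinP; exact: RV_measurable.
move=> w _; rewrite /= -expr2 lee_fin [leRHS]ger0_norm ?addr_ge0 ?sqr_ge0 //.
have h1 := sqr_ge0 (X w - 1); have h2 := sqr_ge0 (X w + 1); have h3 := sqr_ge0 (X w).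
by rewrite ler_norml; apply/andP; rewrite !expr2 in h1 h2 h3 *; split; lra.
Qed.

Lemma gaussian_mean X : standard_gaussian X -> (\int[P]_w (X w)%:E = 0)%E.
Proof.
move=> gX; have mM (s : R) : measurable_fun setT (fun x : R => (Num.max (s * x) 0)%:E).
  apply/measurable_EFinP/measurable_maxr; last exact: measurable_cst.
  exact: measurable_funM.
have M0 (s x : R) : (0 <= (Num.max (s * x) 0)%:E)%E by rewrite lee_fin le_max lexx orbT.
have fin := integrable_fin_num measurableT (integrable_funepos measurableT (gaussian_integrable gX)).
rewrite integralE.
have e1 : (\int[P]_w (fun w => (X w)%:E)^\+ w = \int[@normal_prob R 0 1]_x (Num.max (1 * x) 0)%:E)%E.
  rewrite -(standard_gaussian_integral gX (mM 1) (M0 1)).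
  by apply: eq_integral => w _; rewrite mul1r funeposE -EFin_max.
have e2 : (\int[P]_w (fun w => (X w)%:E)^\- w = \int[@normal_prob R 0 1]_x (Num.max ((- 1) * x) 0)%:E)%E.
  rewrite -(standard_gaussian_integral gX (mM (- 1)) (M0 (- 1))).
  by apply: eq_integral => w _; rewrite mulN1r funenegE -EFin_max.
have E : (\int[@normal_prob R 0 1]_x (Num.max (1 * x) 0)%:E =
          \int[@normal_prob R 0 1]_x (Num.max ((- 1) * x) 0)%:E)%E.
  transitivity (\int[@normal_prob R 0 1]_x (Num.max x 0)%:E)%E.
    by apply: eq_integral => x _; rewrite mul1r.
  by rewrite normal_mean_parts; apply: eq_integral => x _; rewrite mulN1r.
by rewrite e2 -E -e1 subee.
Qed.

(** Independence on rectangles makes the joint law a product measure; Fubini then leaves a multiple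
    of the mean of [Y], which is zero. *)
Lemma gaussian_uncorrelated X Y : standard_gaussian X -> standard_gaussian Y ->
  (forall A B, measurable A -> measurable B ->
     P (X @^-1` A `&` Y @^-1` B) = (P (X @^-1` A) * P (Y @^-1` B))%E) ->
  (\int[P]_w (X w * Y w)%:E = 0)%E.
Proof.
move=> gX gY indep.
have mXY : measurable_fun setT (fun w => (X w, Y w)).
  by apply: measurable_fun_pair; exact: RV_measurable.
pose f (z : R * R) : \bar R := (z.1 * z.2)%:E.
have mf : measurable_fun setT f.
  by apply/measurable_EFinP; apply: measurable_funM; [exact: measurable_fst|exact: measurable_snd].
have iXY : P.-integrable setT (f \o (fun w => (X w, Y w))) := gaussian_integrable_mul gX gY.
have <- : (\int[pushforward P (fun w => (X w, Y w))]_z f z = \int[P]_w (X w * Y w)%:E)%E.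
  by rewrite integral_pushforward.
have ifp : (pushforward P (fun w => (X w, Y w))).-integrable setT f.
  exact: integrable_pushforward.
have prodE Z : measurable Z ->
    (distribution P X \x distribution P Y)%E Z = pushforward P (fun w => (X w, Y w)) Z.
  by apply: product_measure_unique => A B mA mB; exact: indep.
have -> : (\int[pushforward P (fun w => (X w, Y w))]_z f z =
           \int[distribution P X \x distribution P Y]_z f z)%E.
  by apply: eq_measure_integral => A mA _; exact: esym (prodE A mA).
have ifN : (distribution P X \x distribution P Y)%E.-integrable setT f.
  apply/integrableP; split => //; move/integrableP : ifp => [_]; apply: le_lt_trans.
  rewrite le_eqVlt; apply/orP; left; apply/eqP.
  by apply: eq_measure_integral => A mA _; exact: prodE.
rewrite -integral12_prod_meas1 //.
have iY : (distribution P Y).-integrable setT (fun x : R => x%:E).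
  apply: integrable_pushforward => //; first by apply/measurable_EFinP.
  exact: (gaussian_integrable gY).
have Y0 : (\int[distribution P Y]_x x%:E = 0)%E.
  rewrite integral_distribution //; last exact: (gaussian_integrable gY).
  exact: (gaussian_mean gY).
rewrite (eq_integral (cst 0%E)) ?integral0 // => x _; rewrite /fubini_F /f /=.
under eq_integral do rewrite EFinM.
by rewrite integralZl // Y0 mule0.
Qed.

Lemma gaussian_noise_sum_sqr (n J : nat) (e : 'I_n -> 'I_J -> {RV P >-> R}) (j : 'I_J)
    (a : 'I_n -> R) : gaussian_noise e ->
  (\int[P]_w ((\sum_i a i * e i j w) ^+ 2)%:E = (second_moment * \sum_i a i ^+ 2)%:E)%E.
Proof.
move=> [ge ie].
have E w : ((\sum_i a i * e i j w) ^+ 2)%:E =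
    (\sum_i \sum_i' (a i * a i')%:E * (e i j w * e i' j w)%:E)%E.
  rewrite expr2 big_distrlr /= -sumEFin; apply: eq_bigr => i _.
  by rewrite -sumEFin; apply: eq_bigr => i' _; rewrite -EFinM; congr EFin; ring.
under eq_integral do rewrite E.
have int2 i i' : P.-integrable setT (fun w => (a i * a i')%:E * (e i j w * e i' j w)%:E)%E.
  by apply: integrableZl => //; apply: gaussian_integrable_mul.
rewrite integral_sum //; last by move=> i; exact: integrable_sum.
rewrite mulr_sumr -sumEFin; apply: eq_bigr => i _.
rewrite integral_sum // (bigD1 i) //= big1 ?adde0 => [|i' ii'].
  rewrite integralZl //; last exact: gaussian_integrable_mul.
  under eq_integral do rewrite -expr2.
  by rewrite gaussian_sqr // -EFinM mulrC expr2.
rewrite integralZl //; last exact: gaussian_integrable_mul.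
rewrite gaussian_uncorrelated ?mule0 // => A B mA mB.
(* Filling the other indices with [setT] extracts the pair of variables from mutual independence. *)
pose C (p : 'I_n * 'I_J) : set R :=
  if p == (i, j) then A else if p == (i', j) then B else setT.
have mC p : measurable (C p).
  by rewrite /C; case: ifP => _ //; case: ifP => _ //; exact: measurableT.
have pp : (i', j) != (i, j) by apply: contra ii' => /eqP[->].
have := ie C mC; rewrite (bigD1 (i, j)) //= (bigD1 (i', j)) //= big1 ?mule1.
  rewrite {2 3}/C eqxx (negPf pp) eqxx /= => <-; congr (P _).
  apply/seteqP; split => w /=.
    move=> [wA wB] p _ /=; rewrite /C; case: eqP => [-> //|_]; case: eqP => [-> //|//].
  move=> H; split.
    by have := H (i, j) I; rewrite /C /= eqxx.
  by have := H (i', j) I; rewrite /C /= (negPf pp) eqxx.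
move=> p /andP[p1 p2]; rewrite /C (negPf p1) (negPf p2) preimage_setT.
exact: probability_setT.
Qed.

End gaussian_variables.

(** * Least squares *)

Section coefficients.
Variable R : realType.
Implicit Types (u v : nat -> R) (x y : R).

Lemma sqcoef_rot m h u v : sqcoef m (rotc h u v) (rots h u v) = sqcoef m u v.
Proof.
apply: eq_bigr => l _; rewrite /rotc /rots; have := cos2Dsin2 (l%:R * h).
set c := cos _; set s := sin _ => cs.
by rewrite -[RHS]mulr1 -cs; ring.
Qed.

Definition dotcoef m u v u' v' : R := \sum_(1 <= l < m.+1) (u l * u' l + v l * v' l).

Lemma dotcoef_sqr_le m u v u' v' :
  dotcoef m u v u' v' ^+ 2 <= sqcoef m u v * sqcoef m u' v'.
Proof.
(* Indexing by a disjoint union merges the cosine and sine coefficients into a single sum for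
   Cauchy-Schwarz. *)
pose r := [seq inl l | l <- index_iota 1 m.+1] ++ [seq inr l | l <- index_iota 1 m.+1] : seq (nat + nat).
pose a (u v : nat -> R) (i : nat + nat) := match i with inl l => u l | inr l => v l end.
have := sqr_sum_le r (a u v) (a u' v').
by rewrite /r !big_cat !big_map /= -!big_split.
Qed.

Lemma dotcoef_le m u v u' v' :
  `|dotcoef m u v u' v'| <= Num.sqrt (sqcoef m u v) * Num.sqrt (sqcoef m u' v').
Proof.
rewrite -sqrtrM ?sqcoef_ge0 // -sqrtr_sqr ler_sqrt ?dotcoef_sqr_le //.
by rewrite mulr_ge0 ?sqcoef_ge0.
Qed.

Lemma sqcoef_comb m a b u v u' v' :
  sqcoef m (fun l => a * u l - b * u' l) (fun l => a * v l - b * v' l) =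
  a ^+ 2 * sqcoef m u v + b ^+ 2 * sqcoef m u' v' - 2 * a * b * dotcoef m u v u' v'.
Proof.
rewrite /sqcoef /dotcoef !mulr_sumr -big_split /= -sumrB.
by apply: eq_bigr => l _; ring.
Qed.

(** Reverse triangle inequality. As rotations preserve [sqcoef], it yields information on the
    amplitudes that does not depend on the unknown shifts. *)
Lemma sqcoef_comb_ge m a b u v u' v' :
  (`|a| * Num.sqrt (sqcoef m u v) - `|b| * Num.sqrt (sqcoef m u' v')) ^+ 2 <=
  sqcoef m (fun l => a * u l - b * u' l) (fun l => a * v l - b * v' l).
Proof.
rewrite sqcoef_comb; have := dotcoef_le m u v u' v'.
have := sqr_sqrtr (sqcoef_ge0 m u v); have := sqr_sqrtr (sqcoef_ge0 m u' v').
set Y := Num.sqrt _; set X := Num.sqrt _ => <- <- hd.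
rewrite [leLHS](_ : _ = `|a| ^+ 2 * X ^+ 2 + `|b| ^+ 2 * Y ^+ 2 - 2 * (`|a| * `|b| * (X * Y))); last by ring.
rewrite !real_normK ?num_real // lerD2l lerN2 -!mulrA ler_wpM2l //.
by apply: le_trans (ler_norm _) _; rewrite !normrM !ler_wpM2l.
Qed.

Lemma sqcoefB_le m u v u' v' :
  sqcoef m (fun l => u l - u' l) (fun l => v l - v' l) <= 2 * sqcoef m u v + 2 * sqcoef m u' v'.
Proof.
rewrite /sqcoef !mulr_sumr -big_split /=; apply: ler_sum => l _.
have h1 := sqr_ge0 (u l + u' l); have h2 := sqr_ge0 (v l + v' l).
by rewrite !expr2 in h1 h2 *; lra.
Qed.

Lemma sqcoefZ m c u v : sqcoef m (fun l => c * u l) (fun l => c * v l) = c ^+ 2 * sqcoef m u v.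
Proof. by rewrite /sqcoef mulr_sumr; apply: eq_bigr => l _; ring. Qed.

End coefficients.

(** * The contrast as a least squares criterion, and its minimizer *)

Section least_squares.
Variables (R : realType) (n J m : nat).
Implicit Types (y : 'M[R]_(n, J)) (b : param R J) (u v : nat -> R).

(* [chat_re l - i * chat_im l] is twice [chat l]: see [chatE]. *)
Definition chat_re y b (l : nat) : R :=
  2 * ((n%:R * \sum_j ampl b j ^+ 2)^-1 *
  \sum_j ampl b j * \sum_i (y i j - level b j) * cos (l%:R * (design R i - theta b j))).

Definition chat_im y b (l : nat) : R :=
  2 * ((n%:R * \sum_j ampl b j ^+ 2)^-1 *
  \sum_j ampl b j * \sum_i (y i j - level b j) * sin (l%:R * (design R i - theta b j))).

Lemma ReZ (x : R) (z : R[i]) : complex.Re (x%:C * z)%C = x * complex.Re z.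
Proof. by case: z => a c /=; rewrite mul0r subr0. Qed.

Lemma ImZ (x : R) (z : R[i]) : complex.Im (x%:C * z)%C = x * complex.Im z.
Proof. by case: z => a c /=; rewrite mul0r addr0. Qed.

Lemma Re_sum (I : Type) (r : seq I) (F : I -> R[i]) :
  complex.Re (\sum_(i <- r) F i) = \sum_(i <- r) complex.Re (F i).
Proof. by rewrite raddf_sum. Qed.

Lemma Im_sum (I : Type) (r : seq I) (F : I -> R[i]) :
  complex.Im (\sum_(i <- r) F i) = \sum_(i <- r) complex.Im (F i).
Proof. by rewrite raddf_sum. Qed.

Lemma chatE y b (l : nat) : chat y b l%:Z = ((chat_re y b l / 2) +i* (- (chat_im y b l / 2)))%C.
Proof.
have two0 : 2 != 0 :> R by rewrite pnatr_eq0.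
have E (z : R[i]) x w : complex.Re z = x -> complex.Im z = w -> z = (x +i* w)%C.
  by case: z => ? ? /= -> ->.
apply: E; rewrite /chat /chat_re /chat_im mulrAC divff // mul1r ?ReZ ?ImZ -?mulrN.
  congr (_ * _); rewrite Re_sum; apply: eq_bigr => j _; rewrite ReZ; congr (_ * _).
  rewrite Re_sum; apply: eq_bigr => i _; rewrite ReZ; congr (_ * _).
  by rewrite /expi /= cosN.
congr (_ * _); rewrite Im_sum -sumrN; apply: eq_bigr => j _; rewrite ImZ -[RHS]mulrN; congr (_ * _).
rewrite Im_sum -sumrN; apply: eq_bigr => i _; rewrite ImZ -[RHS]mulrN; congr (_ * _).
by rewrite /expi /= sinN.
Qed.

Lemma fhat_trig y b t : fhat m y b t = trig m (chat_re y b) (chat_im y b) t.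
Proof.
rewrite /fhat /fhatC /sum_freq Re_sum; apply: eq_bigr => l _.
have e : (- l%:Z)%:~R * t = - (l%:R * t) :> R by rewrite mulrNz mulNr.
rewrite e raddfD /= chatN !chatE /expi /= cosN sinN.
by field.
Qed.

Lemma contrastE y b : contrast m y b =
  (n%:R * J%:R)^-1 * (\sum_j \sum_i (y i j - level b j) ^+ 2)
  - 2^-1 * sqcoef m (chat_re y b) (chat_im y b).
Proof.
rewrite /contrast; congr (_ - _); rewrite /sum_freq /sqcoef mulr_sumr.
apply: eq_bigr => l _; rewrite chatN !chatE /= !sqr_sqrtr ?addr_ge0 ?sqr_ge0 //.
by field.
Qed.

Definition rss y b u v : R :=
  \sum_j \sum_i (y i j - level b j - ampl b j * trig m u v (design R i - theta b j)) ^+ 2.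

Hypothesis m_n : (2 * m < n)%N.

Lemma sum_trig_sqr_design u v h :
  \sum_(i < n) trig m u v (design R i - h) ^+ 2 = n%:R * (2^-1 * sqcoef m u v).
Proof.
have := discrete_parseval 0 (rotc h u v) (rots h u v) m_n.
rewrite expr0n add0r sqcoef_rot => <-; apply: eq_bigr => i _.
by rewrite add0r trig_shift.
Qed.

(** Completing the square: on the design the energy of a polynomial ignores shifts, and the squared
    amplitudes add up to [J], so the quadratic part in [u], [v] is the same for all parameters. The
    factors [1] match the form of [sqcoef_comb]. *)
Lemma rss_contrast y b u v : (0 < J)%N -> \sum_j ampl b j ^+ 2 = J%:R ->
  (n%:R * J%:R)^-1 * rss y b u v = contrast m y b +
    2^-1 * sqcoef m (fun l => 1 * u l - 1 * chat_re y b l) (fun l => 1 * v l - 1 * chat_im y b l).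
Proof.
move=> J0 aJ; rewrite contrastE sqcoef_comb !expr1n !mul1r mulr1.
have n0 : n%:R != 0 :> R by rewrite pnatr_eq0; lia.
have J0' : J%:R != 0 :> R by rewrite pnatr_eq0 -lt0n.
set z := fun i j => y i j - level b j.
have E j : \sum_i (y i j - level b j - ampl b j * trig m u v (design R i - theta b j)) ^+ 2 =
   \sum_i z i j ^+ 2 + ampl b j ^+ 2 * (n%:R * (2^-1 * sqcoef m u v)) -
   2 * (\sum_(1 <= l < m.+1) (u l * (ampl b j * \sum_i z i j * cos (l%:R * (design R i - theta b j)))
        + v l * (ampl b j * \sum_i z i j * sin (l%:R * (design R i - theta b j))))).
  rewrite -(sum_trig_sqr_design u v (theta b j)).
  have -> : \sum_(1 <= l < m.+1) (u l * (ampl b j * \sum_i z i j * cos (l%:R * (design R i - theta b j)))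
        + v l * (ampl b j * \sum_i z i j * sin (l%:R * (design R i - theta b j)))) =
     \sum_i ampl b j * z i j * trig m u v (design R i - theta b j).
    rewrite /trig; under [RHS]eq_bigr do rewrite mulr_sumr.
    rewrite exchange_big /=; apply: eq_bigr => l _.
    rewrite !mulr_sumr -big_split /=; apply: eq_bigr => i _; ring.
  rewrite !mulr_sumr -big_split /= -sumrB; apply: eq_bigr => i _; rewrite /z; ring.
rewrite /rss (eq_bigr _ (fun j _ => E j)) sumrB big_split /= -mulr_suml aJ -mulr_sumr.
have -> : \sum_j \sum_(1 <= l < m.+1) (u l * (ampl b j * \sum_i z i j * cos (l%:R * (design R i - theta b j)))
        + v l * (ampl b j * \sum_i z i j * sin (l%:R * (design R i - theta b j)))) =
   2^-1 * (n%:R * J%:R) * dotcoef m u v (chat_re y b) (chat_im y b).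
  rewrite exchange_big /dotcoef mulr_sumr; apply: eq_bigr => l _.
  rewrite big_split /= -!mulr_sumr /chat_re /chat_im aJ /z.
  by field; rewrite n0 J0'.
by rewrite /z; field; rewrite n0 J0'.
Qed.

(** Frequency 0 is included for the errors in the levels. *)
Definition noise_energy (e : 'I_n -> 'I_J -> R) : R :=
  \sum_j \sum_(0 <= l < m.+1) ((\sum_i cos (l%:R * design R i) * e i j) ^+ 2 +
                               (\sum_i sin (l%:R * design R i) * e i j) ^+ 2).

(* A trigonometric polynomial of degree [m] only sees the projection of the
   noise on the frequencies at most [m]. *)
Lemma noise_trig_young (e : 'I_n -> 'I_J -> R) j (c s : R) u v :
  2 * s * \sum_i e i j * (c + trig m u v (design R i)) <=
  4^-1 * (n%:R * (c ^+ 2 + 2^-1 * sqcoef m u v)) + 8 * s ^+ 2 / n%:R *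
   \sum_(0 <= l < m.+1) ((\sum_i cos (l%:R * design R i) * e i j) ^+ 2 +
                               (\sum_i sin (l%:R * design R i) * e i j) ^+ 2).
Proof.
have n0 : 0 < n%:R :> R by rewrite ltr0n; lia.
have nn0 := lt0r_neq0 n0.
pose Cn (l : nat) := \sum_i cos (l%:R * design R i) * e i j.
pose Sn (l : nat) := \sum_i sin (l%:R * design R i) * e i j.
(* The weight [n / 8] is a quarter of the Parseval weight [n / 2], so that a quarter of the energy
   of the polynomial is spent. *)
have young (x z : R) : 2 * s * (x * z) <= n%:R / 8 * x ^+ 2 + 8 * s ^+ 2 / n%:R * z ^+ 2.
  rewrite -subr_ge0 (_ : _ - _ = (n%:R * x - 8 * s * z) ^+ 2 / (8 * n%:R)).
    by rewrite divr_ge0 ?sqr_ge0 // mulr_ge0 // ltW.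
  by field; rewrite nn0.
have -> : \sum_i e i j * (c + trig m u v (design R i)) =
   c * Cn 0%N + \sum_(1 <= l < m.+1) (u l * Cn l + v l * Sn l).
  have -> : \sum_(1 <= l < m.+1) (u l * Cn l + v l * Sn l) = \sum_i e i j * trig m u v (design R i).
    rewrite /trig; under [RHS]eq_bigr do rewrite mulr_sumr.
    rewrite exchange_big /=; apply: eq_bigr => l _.
    by rewrite /Cn /Sn !mulr_sumr -big_split; apply: eq_bigr => i _ /=; ring.
  rewrite /Cn mulr_sumr -big_split /=; apply: eq_bigr => i _.
  by rewrite mul0r cos0; ring.
rewrite [X in _ <= _ + _ * X](_ : _ = (Cn 0%N ^+ 2 + Sn 0%N ^+ 2) +
  \sum_(1 <= l < m.+1) (Cn l ^+ 2 + Sn l ^+ 2)); last by rewrite big_ltn.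
rewrite [2 * s * _]mulrDr [8 * s ^+ 2 / n%:R * _]mulrDr.
rewrite (_ : 4^-1 * _ = n%:R / 4 * c ^+ 2 + n%:R / 8 * sqcoef m u v); last by field.
have h0 : 2 * s * (c * Cn 0%N) <= n%:R / 4 * c ^+ 2 + 8 * s ^+ 2 / n%:R * (Cn 0%N ^+ 2 + Sn 0%N ^+ 2).
  apply: (le_trans (young _ _)); rewrite lerD //.
    by rewrite ler_wpM2r ?sqr_ge0 // ler_wpM2l ?ler0n // lef_pV2 ?posrE ?ltr0n // ler_nat.
  apply: ler_wpM2l; last by rewrite lerDl sqr_ge0.
  by apply: divr_ge0; [apply: mulr_ge0; [exact: ler0n|exact: sqr_ge0]|exact: ler0n].
have h1 : 2 * s * \sum_(1 <= l < m.+1) (u l * Cn l + v l * Sn l) <=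
   n%:R / 8 * sqcoef m u v + 8 * s ^+ 2 / n%:R * \sum_(1 <= l < m.+1) (Cn l ^+ 2 + Sn l ^+ 2).
  rewrite /sqcoef !mulr_sumr -big_split /=; apply: ler_sum => l _.
  rewrite mulrDr !mulrDr addrACA; apply: lerD; exact: young.
by rewrite addrACA; apply: lerD.
Qed.

Lemma trig_shift_comb (c a b h g t : R) u v u' v' :
  c + a * trig m u v (t - h) - b * trig m u' v' (t - g) =
  c + trig m (fun l => a * rotc h u v l - b * rotc g u' v' l)
             (fun l => a * rots h u v l - b * rots g u' v' l) t.
Proof. by rewrite !trig_shift !trigZ -addrA trigB. Qed.

(* The residual sum of squares at the minimizer is at most the one at the
   comparison point [(bs, us, vs)]; the cross terms are absorbed by Young's inequality. *)
Lemma least_squares_bound (s vmax : R) (bs bh : param R J) us vs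
    (bias : 'I_n -> 'I_J -> R) (e : 'I_n -> 'I_J -> R) y : (0 < J)%N ->
  (forall i j, y i j = ampl bs j * trig m us vs (design R i - theta bs j) + level bs j
                        + bias i j + s * e i j) ->
  param_space vmax bs -> is_argmin (param_space vmax) (contrast m y) bh ->
  n%:R * \sum_j 2^-1 * sqcoef m
     (fun l => ampl bh j * rotc (theta bh j) (chat_re y bh) (chat_im y bh) l -
               ampl bs j * rotc (theta bs j) us vs l)
     (fun l => ampl bh j * rots (theta bh j) (chat_re y bh) (chat_im y bh) l -
               ampl bs j * rots (theta bs j) us vs l)
  <= 8 * (\sum_j \sum_i bias i j ^+ 2) + 16 * s ^+ 2 / n%:R * noise_energy e.
Proof.
move=> J0 yE As [Ah hmin]; have [_ [_ [as2 _]]] := As; have [_ [_ [ah2 _]]] := Ah.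
set uh := chat_re y bh; set vh := chat_im y bh.
have n0 : 0 < n%:R :> R by rewrite ltr0n; lia.
have J0' : 0 < J%:R :> R by rewrite ltr0n.
(* At [bh] the estimated coefficients make the remainder square vanish; at [bs] it is dropped by
   nonnegativity. *)
have hr : rss y bh uh vh <= rss y bs us vs.
  have nJ : 0 < (n%:R * J%:R)^-1 :> R by rewrite invr_gt0 mulr_gt0.
  rewrite -(ler_pM2l nJ) !rss_contrast // sqcoef_comb.
  have -> : 1 ^+ 2 * sqcoef m uh vh + 1 ^+ 2 * sqcoef m (chat_re y bh) (chat_im y bh) -
     2 * 1 * 1 * dotcoef m uh vh (chat_re y bh) (chat_im y bh) = 0.
    have -> : dotcoef m uh vh (chat_re y bh) (chat_im y bh) = sqcoef m uh vh.
      by apply: eq_bigr => l _; rewrite !expr2.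
    by rewrite /uh /vh; ring.
  rewrite mulr0 addr0; apply: (le_trans (hmin _ As)).
  by rewrite lerDl mulr_ge0 ?sqcoef_ge0.
pose c j := level bh j - level bs j.
pose U j l := ampl bh j * rotc (theta bh j) uh vh l - ampl bs j * rotc (theta bs j) us vs l.
pose V j l := ampl bh j * rots (theta bh j) uh vh l - ampl bs j * rots (theta bs j) us vs l.
pose D (i : 'I_n) j := c j + trig m (U j) (V j) (design R i).
pose r i j := bias i j + s * e i j.
have DE (i : 'I_n) j : D i j = c j + ampl bh j * trig m uh vh (design R i - theta bh j)
   - ampl bs j * trig m us vs (design R i - theta bs j) by rewrite trig_shift_comb.
have e1 : rss y bs us vs = \sum_j \sum_i r i j ^+ 2.
  apply: eq_bigr => j _; apply: eq_bigr => i _; rewrite yE /r; congr (_ ^+ 2); ring.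
have e2 : rss y bh uh vh = \sum_j \sum_i (r i j - D i j) ^+ 2.
  apply: eq_bigr => j _; apply: eq_bigr => i _; rewrite yE DE /r /c; congr (_ ^+ 2); ring.
have DP j : \sum_i D i j ^+ 2 = n%:R * (c j ^+ 2 + 2^-1 * sqcoef m (U j) (V j)).
  exact: discrete_parseval.
(* Bias and noise each absorb a quarter of the energy of [D]; solving for the remaining half doubles
   4 and 8 into 8 and 16. *)
have key j : \sum_i D i j ^+ 2 <= 8 * (\sum_i bias i j ^+ 2) + 16 * s ^+ 2 / n%:R *
   \sum_(0 <= l < m.+1) ((\sum_i cos (l%:R * design R i) * e i j) ^+ 2 +
                               (\sum_i sin (l%:R * design R i) * e i j) ^+ 2)
   + 2 * (\sum_i (r i j - D i j) ^+ 2 - \sum_i r i j ^+ 2).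
  have := noise_trig_young e j (c j) s (U j) (V j); rewrite -DP.
  set W := \sum_(0 <= l < m.+1) _.
  have b1 : \sum_i 2 * (bias i j * D i j) <= \sum_i (4 * bias i j ^+ 2 + 4^-1 * D i j ^+ 2).
    apply: ler_sum => i _; rewrite -subr_ge0.
    rewrite (_ : _ - _ = (2 * bias i j - 2^-1 * D i j) ^+ 2) ?sqr_ge0 //; by field.
  have b2 : \sum_i (r i j - D i j) ^+ 2 = \sum_i r i j ^+ 2 + \sum_i D i j ^+ 2
     - (\sum_i 2 * (bias i j * D i j) + 2 * s * \sum_i e i j * D i j).
    rewrite mulr_sumr -!big_split /= -sumrB; apply: eq_bigr => i _; rewrite /r; ring.
  rewrite b2; rewrite big_split /= -!mulr_sumr in b1.
  rewrite -[\sum_i 2 * _]mulr_sumr.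
  have -> : 16 * s ^+ 2 / n%:R * W = 2 * (8 * s ^+ 2 / n%:R * W) by ring.
  move: (8 * s ^+ 2 / n%:R * W) (2 * s * _) b1 => w z.
  move: (\sum_i bias i j * D i j) (\sum_i D i j ^+ 2) (\sum_i bias i j ^+ 2) (\sum_i r i j ^+ 2).
  by move=> x1 x2 x3 x4 *; lra.
have : \sum_j \sum_i D i j ^+ 2 <= 8 * (\sum_j \sum_i bias i j ^+ 2)
    + 16 * s ^+ 2 / n%:R * noise_energy e + 2 * (rss y bh uh vh - rss y bs us vs).
  rewrite e1 e2 /noise_energy -sumrB !mulr_sumr -!big_split /=.
  by apply: ler_sum => j _; exact: key.
move=> H; apply: (@le_trans _ _ (\sum_j \sum_i D i j ^+ 2)).
  rewrite mulr_sumr; apply: ler_sum => j _; rewrite DP.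
  by apply: ler_wpM2l; [exact: ltW|rewrite lerDr sqr_ge0].
by apply: (le_trans H); rewrite gerDl pmulr_rle0 // subr_le0.
Qed.

(* Comparing norms over all the curves identifies the norm of the shape, since
   the squared amplitudes add up to [J]; the curve with a known shift and a
   positive amplitude then identifies the shape. *)
Lemma shape_identification (vmax : R) (bs bh : param R J) us vs uh vh (j0 : 'I_J) :
  j0 = 0%N :> nat -> param_space vmax bs -> param_space vmax bh ->
  ampl bs j0 ^+ 2 * sqcoef m (fun l => uh l - us l) (fun l => vh l - vs l) <=
  10 * \sum_j sqcoef m
     (fun l => ampl bh j * rotc (theta bh j) uh vh l - ampl bs j * rotc (theta bs j) us vs l)
     (fun l => ampl bh j * rots (theta bh j) uh vh l - ampl bs j * rots (theta bs j) us vs l).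
Proof.
move=> j00 [_ [_ [as2 /(_ _ j00) [ts0 as0]]]] [_ [_ [ah2 /(_ _ j00) [th0 ah0]]]].
have J0 : 0 < J%:R :> R by rewrite ltr0n; exact: leq_ltn_trans (leq0n _) (ltn_ord j0).
set X := Num.sqrt (sqcoef m uh vh); set Y := Num.sqrt (sqcoef m us vs).
have X0 : 0 <= X by exact: sqrtr_ge0.
have Y0 : 0 <= Y by exact: sqrtr_ge0.
pose S j := sqcoef m
     (fun l => ampl bh j * rotc (theta bh j) uh vh l - ampl bs j * rotc (theta bs j) us vs l)
     (fun l => ampl bh j * rots (theta bh j) uh vh l - ampl bs j * rots (theta bs j) us vs l).
rewrite -/(\sum_j S j).
have S0 j : 0 <= S j by exact: sqcoef_ge0.
have hS j : (`|ampl bh j| * X - `|ampl bs j| * Y) ^+ 2 <= S j.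
  rewrite /X -(sqcoef_rot m (theta bh j)) /Y -(sqcoef_rot m (theta bs j) us).
  exact: sqcoef_comb_ge.
set U := \sum_j S j.
have S1 : S j0 <= U by rewrite /U (bigD1 j0) //= lerDl sumr_ge0.
have a1J : ampl bs j0 ^+ 2 <= J%:R.
  by rewrite -as2 (bigD1 j0) //= lerDl sumr_ge0 // => j _; rewrite sqr_ge0.
(* Each product of absolute amplitudes is at most the mean of their squares; after summing, both
   families of squares give [J]. *)
have hXY : J%:R * (X - Y) ^+ 2 <= U.
  apply: (@le_trans _ _ (\sum_j (ampl bh j ^+ 2 * X ^+ 2 + ampl bs j ^+ 2 * Y ^+ 2
      - (ampl bh j ^+ 2 + ampl bs j ^+ 2) * (X * Y)))).
    rewrite sumrB big_split /= -!mulr_suml big_split /= ah2 as2.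
    by rewrite le_eqVlt; apply/orP; left; apply/eqP; ring.
  apply: ler_sum => j _; apply: le_trans (hS j).
  rewrite -(real_normK (num_real (ampl bh j))) -(real_normK (num_real (ampl bs j))).
  rewrite -subr_ge0 (_ : _ - _ = (`|ampl bh j| - `|ampl bs j|) ^+ 2 * (X * Y)); last by ring.
  by rewrite mulr_ge0 ?sqr_ge0 // mulr_ge0.
have h1 := hS j0; rewrite !gtr0_norm // in h1.
set a := ampl bs j0 in as0 a1J h1 *; set A := ampl bh j0 in ah0 h1 *.
(* On the first curve there is no rotation, and [a * (uh - us) = (A * uh - a * us) - (A - a) * uh].
   Then [(A - a) * X = (A * X - a * Y) - a * (X - Y)] controls the last term, for a total of
   [2 + 4 + 4 = 10]. *)
have hd : a ^+ 2 * sqcoef m (fun l => uh l - us l) (fun l => vh l - vs l)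
   <= 2 * S j0 + 2 * ((A - a) ^+ 2 * X ^+ 2).
  rewrite -sqcoefZ /X sqr_sqrtr ?sqcoef_ge0 // -(sqcoefZ _ (A - a)).
  apply: le_trans (sqcoefB_le _ _ _ _ _); rewrite le_eqVlt; apply/orP; left; apply/eqP.
  apply: eq_bigr => l _; rewrite th0 ts0 /rotc /rots mulr0 cos0 sin0 -/a -/A; ring.
apply: (le_trans hd).
have h2 : (A - a) ^+ 2 * X ^+ 2 <= 2 * (A * X - a * Y) ^+ 2 + 2 * (a ^+ 2 * (X - Y) ^+ 2).
  rewrite -subr_ge0 (_ : _ - _ = ((A * X - a * Y) + a * (X - Y)) ^+ 2) ?sqr_ge0 //; ring.
have h3 : a ^+ 2 * (X - Y) ^+ 2 <= U.
  by apply: le_trans hXY; rewrite ler_wpM2r ?sqr_ge0.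
move: ((A - a) ^+ 2 * X ^+ 2) ((A * X - a * Y) ^+ 2) (a ^+ 2 * (X - Y) ^+ 2) h1 h2 h3 S1 {hXY}.
by move: (S j0) (U) => x1 x2 x3 x4 x5 *; lra.
Qed.

End least_squares.

(** * Measurability and risk *)

Section measurability.
Context d (T : measurableType d) (R : realType) (P : probability T R).

Lemma measurable_cosT d' (S : measurableType d') (g : S -> R) :
  measurable_fun setT g -> measurable_fun setT (fun w => cos (g w)).
Proof.
move=> mg; apply: (measurableT_comp (f := @cos R)) => //.
by apply: continuous_measurable_fun; exact: continuous_cos.
Qed.

Lemma measurable_sinT d' (S : measurableType d') (g : S -> R) :
  measurable_fun setT g -> measurable_fun setT (fun w => sin (g w)).
Proof.
move=> mg; apply: (measurableT_comp (f := @sin R)) => //.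
by apply: continuous_measurable_fun; exact: continuous_sin.
Qed.

Section estimator.
Variables (n J : nat) (y : T -> 'M[R]_(n, J)) (b : T -> param R J).
Hypothesis my : forall i j, measurable_fun setT (fun w => y w i j).
Hypothesis mb : measurable_param b.

Let normalizer (w : T) : R := (n%:R * \sum_j ampl (b w) j ^+ 2)^-1.

Let measurable_normalizer : measurable_fun setT normalizer.
Proof.
(* The inverse is written as a real power, measurable in its base, with which it agrees on
   nonnegative numbers. *)
rewrite (_ : normalizer = fun w => (n%:R * \sum_j ampl (b w) j ^+ 2) `^ (-1)).
  apply: (measurableT_comp (f := @powR R ^~ (-1))); first exact: measurable_powR.
  apply: measurable_funM; first exact: measurable_cst.
  apply: measurable_sum => j; apply: measurable_funX; by have [] := mb j.
apply/funext => w; rewrite powR_inv1 // mulr_ge0 // sumr_ge0 // => j _.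
exact: sqr_ge0.
Qed.

Let measurable_phase l (i : 'I_n) (j : 'I_J) :
  measurable_fun setT (fun w => l%:R * (design R i - theta (b w) j)).
Proof.
have [mt _ _] := mb j; apply: measurable_funM; first exact: measurable_cst.
by apply: measurable_funB => //; exact: measurable_cst.
Qed.

Lemma measurable_chat_re l : measurable_fun setT (fun w => chat_re (y w) (b w) l).
Proof.
apply: measurable_funM; first exact: measurable_cst.
apply: measurable_funM; first exact: measurable_normalizer.
apply: measurable_sum => j; have [_ ma ml] := mb j; apply: measurable_funM => //.
apply: measurable_sum => i; apply: measurable_funM; first exact: measurable_funB.
exact/measurable_cosT/measurable_phase.
Qed.

Lemma measurable_chat_im l : measurable_fun setT (fun w => chat_im (y w) (b w) l).
Proof.
apply: measurable_funM; first exact: measurable_cst.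
apply: measurable_funM; first exact: measurable_normalizer.
apply: measurable_sum => j; have [_ ma ml] := mb j; apply: measurable_funM => //.
apply: measurable_sum => i; apply: measurable_funM; first exact: measurable_funB.
exact/measurable_sinT/measurable_phase.
Qed.

End estimator.

Variables (m : nat) (u v : T -> nat -> R).
Hypotheses (mu : forall l, measurable_fun setT (u ^~ l))
           (mv : forall l, measurable_fun setT (v ^~ l)).

Lemma measurable_trig t : measurable_fun setT (fun w => trig m (u w) (v w) t).
Proof.
apply: measurable_sum => l; apply: measurable_funD; apply: measurable_funM.
- exact: mu.
- exact: measurable_cst.
- exact: mv.
- exact: measurable_cst.
Qed.

Lemma measurable_trig_prod :
  measurable_fun setT (fun z : T * measurableTypeR R => trig m (u z.1) (v z.1) z.2).
Proof.
have m2 l : measurable_fun setT (fun z : T * measurableTypeR R => l%:R * (z.2 : R)).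
  by apply: measurable_funM; [exact: measurable_cst|exact: measurable_snd].
apply: measurable_sum => l; apply: measurable_funD; apply: measurable_funM.
- exact: (measurableT_comp (mu l) measurable_fst).
- exact: (measurable_cosT (m2 l)).
- exact: (measurableT_comp (mv l) measurable_fst).
- exact: (measurable_sinT (m2 l)).
Qed.

Variable f : R -> R.
Hypothesis cf : continuous f.

Let err w : R := circ_int (fun t => (trig m (u w) (v w) t - f t) ^+ 2).

(** The pathwise bound controls the integral over [t] for fixed [w], while the risk integrates over
    [w] first. *)
Lemma tonelli_trig :
  measurable_fun setT (fun w => (err w)%:E) /\
  (\int[lebesgue_measure]_(t in `[0%R, (2 * pi)%R])
     \int[P]_w (((trig m (u w) (v w) t - f t) ^+ 2)%R)%:E = \int[P]_w (err w)%:E)%E.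
Proof.
pose g (z : T * measurableTypeR R) : \bar R :=
  ((trig m (u z.1) (v z.1) z.2 - f z.2) ^+ 2 * \1_(`[0, 2 * pi] : set R) z.2)%:E.
have g0 z : (0 <= g z)%E by rewrite lee_fin mulr_ge0 ?sqr_ge0.
have mg : measurable_fun setT g.
  apply/measurable_EFinP; apply: measurable_funM.
    apply: measurable_funX; apply: measurable_funB; first exact: measurable_trig_prod.
    apply: (measurableT_comp (f := f)); last exact: measurable_snd.
    exact: continuous_measurable_fun.
  have mI : measurable_fun setT (\1_(`[0, 2 * pi] : set R) : measurableTypeR R -> R).
    exact: measurable_indic.
  exact: (measurableT_comp mI measurable_snd).
have gE w : (\int[lebesgue_measure]_t g (w, t) = (err w)%:E)%E.
  rewrite /err /circ_int /Rintegral fineK.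
    rewrite [RHS]integral_mkcond; apply: eq_integral => t _.
    by rewrite patchE /g /= indicE; case: ifP => _; rewrite ?mulr1 ?mulr0.
  apply: integrable_fin_num => //; apply: circ_integrable.
  apply: circ_contX; apply: circ_contB; first exact: circ_trig.
  exact: circ_contT.
split.
  have := measurable_fun_fubini_tonelli_F (m2 := lebesgue_measure) g mg g0.
  by apply: eq_measurable_fun => w _; rewrite -gE.
under [RHS]eq_integral do rewrite -gE.
rewrite (@fubini_tonelli _ _ _ _ _ P lebesgue_measure g mg g0).
rewrite integral_mkcond; apply: eq_integral => t _.
rewrite patchE /g /= indicE; case: ifP => _.
  by apply: eq_integral => w _; rewrite mulr1.
by rewrite integral0_eq // => w _; rewrite mulr0.
Qed.

(** The distance is continuous in [t], so exceeding [a] somewhere means exceeding it at some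
    rational: a countable union. *)
Lemma measurable_sup_dist (a : R) :
  measurable [set w | (a%:E < sup_dist (trig m (u w) (v w)) f)%E].
Proof.
rewrite (_ : mkset _ = \bigcup_(q : rat)
   [set w | a < `|trig m (u w) (v w) (ratr q) - f (ratr q)|]).
  apply: bigcupT_measurable_rat => q.
  have mh : measurable_fun setT (fun w => `|trig m (u w) (v w) (ratr q) - f (ratr q)|).
    apply: measurableT_comp => //; apply: measurable_funB; last exact: measurable_cst.
    exact: measurable_trig.
  rewrite -[X in measurable X]setTI.
  exact: (measurable_fun_ltr (measurable_cst a) mh).
apply/seteqP; split => w /=; last first.
  move=> [q _ /= aq]; apply: lt_le_trans (ereal_sup_ubound _); last first.
    by exists (ratr q).
  by rewrite lte_fin.
move=> /ereal_sup_gt [_ [t _ <-]]; rewrite lte_fin => at_.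
have ch : continuous (fun t => `|trig m (u w) (v w) t - f t|).
  move=> x; apply: cvg_norm; apply: cvgB; last exact: cf.
  exact: continuous_trig.
have oO : open [set t | a < `|trig m (u w) (v w) t - f t|].
  by apply: (open_comp (D := [set x | a < x])) => [x _|]; [exact: ch|exact: open_gt].
have [x [/= xO [q _ xq]]] := dense_rat (ex_intro _ t at_) oO.
by exists q => //=; rewrite xq.
Qed.

End measurability.

Section risk.
Context d (T : measurableType d) (R : realType) (P : probability T R).

Lemma measurable_noise_energy (n J m : nat) (e : 'I_n -> 'I_J -> {RV P >-> R}) :
  measurable_fun setT (fun w => noise_energy m (fun i j => e i j w)).
Proof.
apply: measurable_sum => j; apply: measurable_sum => l.
by apply: measurable_funD; apply: measurable_funX; apply: measurable_sum => i;
  apply: measurable_funM; (exact: measurable_cst || exact: RV_measurable).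
Qed.

Lemma noise_energy_ge0 (n J m : nat) (e : 'I_n -> 'I_J -> R) : 0 <= noise_energy m e.
Proof.
by apply: sumr_ge0 => j _; apply: sumr_ge0 => l _; rewrite addr_ge0 ?sqr_ge0.
Qed.

(** At each frequency the squared cosine and sine weights add up to 1 at every design point, which
    gives [second_moment * n] for each curve. *)
Lemma expected_noise_energy (n J m : nat) (e : 'I_n -> 'I_J -> {RV P >-> R}) :
  gaussian_noise e ->
  (\int[P]_w (noise_energy m (fun i j => e i j w))%:E =
   (second_moment R * (J%:R * (m.+1%:R * n%:R)))%:E)%E.
Proof.
move=> ge; rewrite /noise_energy.
have mS (j : 'I_J) (a : 'I_n -> R) :
    measurable_fun setT (fun w => ((\sum_i a i * e i j w) ^+ 2)%:E).
  apply/measurable_EFinP; apply: measurable_funX; apply: measurable_sum => i.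
  by apply: measurable_funM; [exact: measurable_cst|exact: RV_measurable].
under eq_integral do rewrite -sumEFin.
under eq_integral do under eq_bigr do rewrite -sumEFin.
under eq_integral do under eq_bigr do under eq_bigr do rewrite EFinD.
rewrite ge0_integral_sum //; last 2 first.
- move=> j; apply: emeasurable_sum => l; exact: emeasurable_funD.
- by move=> j w _; apply: sume_ge0 => l _; rewrite adde_ge0 // lee_fin sqr_ge0.
rewrite [RHS](_ : _ = (\sum_(j < J) (second_moment R * (m.+1%:R * n%:R))%:E)%E); last first.
  by rewrite sumEFin sumr_const card_ord -[in RHS]mulr_natl; congr EFin; ring.
apply: eq_bigr => j _.
rewrite ge0_integral_sum //; last 2 first.
- by move=> l; exact: emeasurable_funD.
- by move=> l w _; rewrite adde_ge0 // lee_fin sqr_ge0.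
rewrite [RHS](_ : _ = (\sum_(0 <= l < m.+1) (second_moment R * n%:R)%:E)%E); last first.
  by rewrite sumEFin sumr_const_nat subn0 -[in RHS]mulr_natl; congr EFin; ring.
apply: eq_bigr => l _.
rewrite ge0_integralD //; try by move=> w _; rewrite lee_fin sqr_ge0.
rewrite (gaussian_noise_sum_sqr j (fun i => cos (l%:R * design R i)) ge).
rewrite (gaussian_noise_sum_sqr j (fun i => sin (l%:R * design R i)) ge).
rewrite -EFinD -mulrDr -big_split /=; congr (_ * _)%:E.
by under eq_bigr do rewrite cos2Dsin2; rewrite sumr_const card_ord.
Qed.

Lemma coefficient_error (n J m k : nat) (vmax s B : R) (bs bh : param R J) (f : R -> R)
    (e : 'I_n -> 'I_J -> R) (j0 : 'I_J) (us vs : nat -> R) (y : 'M[R]_(n, J)) :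
  j0 = 0%N :> nat -> (0 < m)%N -> (2 * m < n)%N ->
  (forall h, \sum_(i < n) (f (design R i - h) - trig m us vs (design R i - h)) ^+ 2
            <= n%:R * (B / m%:R ^+ (2 * k))) ->
  y = observations bs s f e -> param_space vmax bs ->
  is_argmin (param_space vmax) (contrast m y) bh ->
  sqcoef m (fun l => chat_re y bh l - us l) (fun l => chat_im y bh l - vs l) <=
   160 * J%:R * B / ampl bs j0 ^+ 2 / m%:R ^+ (2 * k) +
   320 * s ^+ 2 / ampl bs j0 ^+ 2 / n%:R ^+ 2 * noise_energy m e.
Proof.
move=> j00 m0 mn hB yE As hmin; have [Ah _] := hmin.
have [_ [_ [as2 /(_ _ j00) [_ a0]]]] := As.
have J0 : (0 < J)%N by exact: leq_ltn_trans (leq0n _) (ltn_ord j0).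
have n0 : 0 < n%:R :> R by rewrite ltr0n; lia.
pose bias (i : 'I_n) (j : 'I_J) := ampl bs j * (f (design R i - theta bs j)
   - trig m us vs (design R i - theta bs j)).
have yE' i j : y i j = ampl bs j * trig m us vs (design R i - theta bs j) + level bs j
                        + bias i j + s * e i j.
  by rewrite yE mxE /bias; ring.
have h1 := least_squares_bound mn J0 yE' As hmin.
have h2 := shape_identification m us vs (chat_re y bh) (chat_im y bh) j00 As Ah.
have h3 : \sum_j \sum_i bias i j ^+ 2 <= J%:R * (n%:R * (B / m%:R ^+ (2 * k))).
  rewrite -as2 mulr_suml; apply: ler_sum => j _.
  rewrite (eq_bigr (fun i => ampl bs j ^+ 2 * (f (design R i - theta bs j)
     - trig m us vs (design R i - theta bs j)) ^+ 2)); last by move=> i _; rewrite exprMn.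
  by rewrite -mulr_sumr ler_wpM2l ?sqr_ge0.
set U := \sum_j sqcoef m _ _ in h2; rewrite -mulr_sumr -/U in h1.
set S := sqcoef m _ _ in h2 *; set D := m%:R ^+ (2 * k) in h3 *.
have D0 : D != 0 by rewrite expf_neq0 // pnatr_eq0 -lt0n.
have nn0 := lt0r_neq0 n0; have an0 := lt0r_neq0 a0.
have a20 : 0 < ampl bs j0 ^+ 2 by rewrite exprn_gt0.
rewrite -(ler_pM2l a20); apply: (le_trans h2).
(* The factor 10 comes from [shape_identification] and 2 from the [2^-1] of Parseval; with 8 and 16
   from the least squares bound they give 160 and 320. *)
have h4 : n%:R * (10 * U) <= n%:R * (ampl bs j0 ^+ 2 *
  (160 * J%:R * B / ampl bs j0 ^+ 2 / D + 320 * s ^+ 2 / ampl bs j0 ^+ 2 / n%:R ^+ 2 * noise_energy m e)).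
  rewrite [leRHS](_ : _ = 20 * (8 * (J%:R * (n%:R * (B / D))) + 16 * s ^+ 2 / n%:R * noise_energy m e)); last first.
    by field; rewrite D0 nn0 an0.
  rewrite [leLHS](_ : _ = 20 * (n%:R * (2^-1 * U))); last by field.
  rewrite ler_wpM2l //; apply: (le_trans h1).
  by rewrite lerD2r ler_wpM2l.
by rewrite ler_pM2l in h4.
Qed.

End risk.

(** * From the coefficient error to the integrated and uniform errors *)

Section rates.
Context d (T : measurableType d) (R : realType) (P : probability T R).

(* [W] stands for the noise energy, [us] and [vs] for the Fourier coefficients of [f]. *)
Variables (m : nat) (u v : T -> nat -> R) (us vs : nat -> R) (f : R -> R).
Variables (W : T -> R) (k1 k2 b0 b1 : R).
Hypotheses (mu : forall l, measurable_fun setT (u ^~ l))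
           (mv : forall l, measurable_fun setT (v ^~ l)).
Hypothesis mW : measurable_fun setT W.
Hypothesis W0 : forall w, 0 <= W w.
Hypotheses (k1_ge0 : 0 <= k1) (k2_ge0 : 0 <= k2) (b0_ge0 : 0 <= b0).
Hypothesis cf : continuous f.

Let Delta w := sqcoef m (fun l => u w l - us l) (fun l => v w l - vs l).

Hypothesis hDelta : {ae P, forall w, Delta w <= k1 + k2 * W w}.
Hypothesis hint : circ_int (fun t => (f t - trig m us vs t) ^+ 2) <= b0.
Hypothesis hsup : forall t, (f t - trig m us vs t) ^+ 2 <= b1.

Let trigBE w t : trig m (u w) (v w) t - trig m us vs t =
  trig m (fun l => u w l - us l) (fun l => v w l - vs l) t.
Proof. exact: trigB. Qed.

Lemma integrated_error_le :
  (\int[lebesgue_measure]_(t in `[0%R, (2 * pi)%R])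
     \int[P]_w (((trig m (u w) (v w) t - f t) ^+ 2)%R)%:E <=
   (2 * pi * k1 + 2 * b0)%:E + (2 * pi * k2)%:E * \int[P]_w (W w)%:E)%E.
Proof.
have [merr ->] := tonelli_trig P m mu mv cf.
have p0 : 0 <= pi :> R := pi_ge0 R.
have c0 : 0 <= 2 * pi * k1 + 2 * b0 by rewrite addr_ge0 ?mulr_ge0.
have c1 : 0 <= 2 * pi * k2 by rewrite !mulr_ge0.
have mWE : measurable_fun setT (fun w => (W w)%:E) by apply/measurable_EFinP.
have mkW : measurable_fun setT (fun w => (2 * pi * k2)%:E * (W w)%:E)%E.
  by apply: emeasurable_funM => //; exact: measurable_cst.
apply: (@le_trans _ _ (\int[P]_w ((2 * pi * k1 + 2 * b0)%:E + (2 * pi * k2)%:E * (W w)%:E))%E); last first.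
  rewrite ge0_integralD //; last by move=> w _; rewrite mule_ge0 ?lee_fin.
  rewrite ge0_integralZl //; last by move=> w _; rewrite lee_fin.
  by rewrite integral_cst // [X in (_ * X)%E](_ : _ = 1%E) ?mule1 //; exact: probability_setT.
apply: ae_ge0_le_integral => //.
- by move=> w _; rewrite lee_fin; apply: circ_int_ge0 => t; exact: sqr_ge0.
- by move=> w _; rewrite adde_ge0 ?mule_ge0 ?lee_fin.
- by apply: emeasurable_funD => //; exact: measurable_cst.
apply: filterS hDelta => w hw _; rewrite -EFinM -EFinD lee_fin.
have cu : circ_cont (trig m (u w) (v w)) by exact: circ_trig.
have cs : circ_cont (trig m us vs) by exact: circ_trig.
have cf' := circ_contT cf.
have cA := circ_contX (n := 2) (circ_contB cu cs).
have cB := circ_contX (n := 2) (circ_contB cf' cs).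
have cC := circ_contX (n := 2) (circ_contB cu cf').
apply: (le_trans (le_circ_int cC (circ_contD (circ_contZ (c := 2) cA) (circ_contZ (c := 2) cB)) _)).
  move=> t _; rewrite (_ : _ - f t = (trig m (u w) (v w) t - trig m us vs t) + - (f t - trig m us vs t)).
    by apply: le_trans (sqrD_le _ _) _; rewrite sqrrN.
  by ring.
rewrite (circ_intD (circ_contZ (c := 2) cA) (circ_contZ (c := 2) cB)).
rewrite (circ_intZ _ cA) (circ_intZ _ cB).
rewrite (eq_circ_int (fun t _ => congr1 (fun x => x ^+ 2) (trigBE w t))) circ_parseval -/(Delta w).
have h1 : pi * Delta w <= pi * (k1 + k2 * W w) by rewrite ler_wpM2l.
rewrite [leRHS](_ : _ = 2 * (pi * (k1 + k2 * W w)) + 2 * b0); last by ring.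
by apply: lerD; rewrite ler_wpM2l.
Qed.

Lemma sup_dist_le w (M : R) : 0 <= M ->
  Delta w <= k1 + k2 * W w ->
  2 * m%:R * (k1 + k2 * W w) + 2 * b1 <= M ^+ 2 ->
  (sup_dist (trig m (u w) (v w)) f <= M%:E)%E.
Proof.
move=> M0 hw hM; apply: ge_ereal_sup => _ [t _ <-]; rewrite lee_fin.
rewrite -(ler_pXn2r (n := 2)) ?nnegrE ?normr_ge0 // real_normK ?num_real //.
apply: le_trans hM.
rewrite (_ : _ - f t = (trig m (u w) (v w) t - trig m us vs t) + - (f t - trig m us vs t)); last by ring.
apply: le_trans (sqrD_le _ _) _; rewrite sqrrN; apply: lerD; last by rewrite ler_wpM2l.
rewrite -mulrA ler_wpM2l // trigBE; apply: (le_trans (trig_sqr_le _ _ _ _)).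
by rewrite ler_wpM2l.
Qed.

(** Outside the null set of [hDelta], a distance above [K * r] forces [W w] to reach [q]; Markov's
    inequality bounds the probability of that. *)
Lemma sup_dist_tail (r K q c : R) : 0 < r -> 0 <= K -> 0 < q ->
  (\int[P]_w (W w)%:E <= (q * c)%:E)%E ->
  2 * m%:R * (k1 + k2 * q) + 2 * b1 <= (K * r) ^+ 2 ->
  (P [set w | K%:E < `|sup_dist (trig m (u w) (v w)) f * (r^-1)%:E|] <= c%:E)%E.
Proof.
move=> r0 K0 q0 hW hK.
have mWE : measurable_fun setT (fun w => (W w)%:E) by apply/measurable_EFinP.
pose A := [set w | ((K * r)%:E < sup_dist (trig m (u w) (v w)) f)%E].
pose E := [set w | (q%:E <= `|(W w)%:E|)%E].
have -> : [set w | (K%:E < `|sup_dist (trig m (u w) (v w)) f * (r^-1)%:E|)%E] = A.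
  have sup0 w : (0 <= sup_dist (trig m (u w) (v w)) f)%E.
    by apply: le_trans (ereal_sup_ubound _); last (by exists 0); rewrite lee_fin.
  apply/funext => w; rewrite /A /= gee0_abs; first by rewrite lte_pdivlMr.
  by rewrite mule_ge0 // lee_fin invr_ge0 ltW.
have mA : measurable A by exact: measurable_sup_dist.
have mE : measurable E.
  rewrite -[E]setTI; apply: (emeasurable_fun_c_infty measurableT).
  exact: measurableT_comp.
have [N [mN N0 hN]] := hDelta.
have AE : A `<=` N `|` E.
  move=> w Aw; have [Nw|Nw] := pselect (N w); [by left|right].
  rewrite /E /= leNgt; apply/negP => Ew.
  have hw : Delta w <= k1 + k2 * W w by apply: contrapT => h; apply: Nw; exact: hN.
  have : (sup_dist (trig m (u w) (v w)) f <= (K * r)%:E)%E.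
    apply: sup_dist_le => //; first by rewrite mulr_ge0 // ltW.
    apply: le_trans hK; rewrite lerD2r ler_wpM2l ?mulr_ge0 // lerD2l ler_wpM2l //.
    by move: Ew; rewrite lte_fin ger0_norm // => /ltW.
  by rewrite leNgt => /negP; apply.
have PE : (P A <= P E)%E.
  apply: (@le_trans _ _ (P (N `|` E))).
    by apply: le_measure => //; rewrite inE //; exact: measurableU.
  have PU := measureU2 P mN mE; rewrite [X in (_ <= X + _)%E](_ : _ = 0%E) ?add0e // in PU.
apply: (le_trans PE).
have := le_integral_abse P measurableT mWE q0; rewrite setTI -/E => h.
have h' : (q%:E * P E <= (q * c)%:E)%E.
  apply: (le_trans h); apply: le_trans hW; rewrite le_eqVlt; apply/orP; left; apply/eqP.
  by apply: eq_integral => w _; rewrite gee0_abs // lee_fin.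
have fE : P E \is a fin_num by exact: fin_num_measure.
by move: h'; rewrite -(fineK fE) -EFinM !lee_fin ler_pM2l.
Qed.

End rates.

(** * Balancing bias and variance *)

Section asymptotics.
Variable R : realType.

Lemma powR_half_sqr (a : R) (k : nat) : 0 < a -> (0 < k)%N ->
  ((a `^ (k%:R - 2^-1))^-1) ^+ 2 = (a ^+ (2 * k).-1)^-1.
Proof.
move=> a0 k0; rewrite exprVn; congr (_^-1).
rewrite -(powR_mulrn 2) ?powR_ge0 // -powRrM -(powR_mulrn (2 * k).-1) ?ltW //.
congr (_ `^ _); rewrite -subn1 natrB ?muln_gt0 // natrM; by field.
Qed.

Lemma balanced_rate (m : nat -> nat) (k : nat) : (0 < k)%N ->
  (fun n => (m n)%:R : R) ~_odd_oo (fun n => n%:R `^ ((2 * k + 1)%:R^-1)) ->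
  \forall n \near odd_oo, ((m n)%:R ^+ (2 * k))^-1 + (m n)%:R / n%:R <=
    (2 ^+ (2 * k) + 2) * n%:R `^ (- ((2 * k)%:R / (2 * k + 1)%:R)) :> R.
Proof.
move=> k0 /eqaddoP /(_ (2^-1)); rewrite invr_gt0 ltr0n => /(_ isT).
rewrite /odd_oo => -[N _ H]; exists N.+1 => // n /= Nn on.
(* With tolerance [2^-1], [m n] lies between [q / 2] and [3 * q / 2]: the lower bound produces
   [2 ^ (2 * k)] for the bias, and the upper one at most 2 for the variance, as
   [q / n = q ^- (2 * k)]. *)
have := H n (ltnW Nn) on; rewrite /= !fctE.
have n0 : 0 < n%:R :> R by rewrite ltr0n; exact: leq_trans Nn.
set a : R := (2 * k + 1)%:R^-1; set q := n%:R `^ a.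
have q0 : 0 < q by rewrite powR_gt0.
rewrite (gtr0_norm q0) ler_norml => /andP[h1 h2].
have d0 : (2 * k + 1)%:R != 0 :> R by rewrite pnatr_eq0 addn1.
have e1 : n%:R `^ (- ((2 * k)%:R / (2 * k + 1)%:R)) = q ^- (2 * k).
  rewrite powRN; congr (_^-1); rewrite -(powR_mulrn (2 * k)) ?ltW // /q -powRrM.
  by congr (_ `^ _); rewrite mulrC.
have e2 : q / n%:R = q ^- (2 * k).
  have -> : n%:R = q ^+ (2 * k + 1) :> R.
    by rewrite -(powR_mulrn (2 * k + 1)) ?ltW // /q -powRrM mulVf // powRr1 // ltW.
  by rewrite exprD expr1 invfM mulrCA divff ?mulr1 // gt_eqF.
rewrite e1 mulrDl; apply: lerD.
  have h : q / 2 <= (m n)%:R by lra.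
  rewrite -[X in X * _]invrK -invfM lef_pV2 ?posrE.
  - rewrite -exprVn -exprMn lerXn2r ?nnegrE //; last by rewrite mulrC.
    by rewrite mulr_ge0 ?invr_ge0 // ltW.
  - by rewrite exprn_gt0 //; apply: lt_le_trans h; rewrite divr_gt0.
  - by rewrite mulr_gt0 ?invr_gt0 ?exprn_gt0.
rewrite -e2 mulrA ler_wpM2r ?invr_ge0 ?ltW //; lra.
Qed.

End asymptotics.

Theorem corollary3p1 (R : realType) (d : measure_display) (T : measurableType d)
  (P : probability T R) (J : nat) (vmax : R)
  (bstar : param R J) (sigma : R) (fstar : R -> R)
  (m : nat -> nat) (eps : forall n : nat, 'I_n -> 'I_J -> {RV P >-> R})
  (bhat : nat -> T -> param R J) (k : nat) :
  (2 <= J)%N -> 0 < vmax ->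
  param_space vmax bstar -> 0 < sigma -> shape_space fstar ->
  (forall n, odd n -> (2 < n)%N -> (0 < m n)%N /\ (2 * m n < n)%N) ->
  (forall n p, odd n -> odd p -> (2 < n)%N -> (n <= p)%N -> (m n <= m p)%N) ->
  m @ odd_oo --> \oo ->
  (forall n, odd n -> (2 < n)%N -> gaussian_noise (@eps n)) ->
  let Y n (w : T) : 'M[R]_(n, J) :=
    observations bstar sigma fstar (fun i j => @eps n i j w) in
  (forall n, odd n -> (2 < n)%N ->
     measurable_param (bhat n) /\
     {ae P, forall w, is_argmin (param_space vmax)
                        (contrast (m n) (Y n w)) (bhat n w)}) ->
  let f_ n (w : T) : R -> R := fhat (m n) (Y n w) (bhat n w) in
  (1 <= k)%N -> Ck k fstar ->
  (\int[lebesgue_measure]_(t in `[0%R, (2 * pi)%R])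
     ((`|derive1n k fstar t| ^+ 2)%:E) < +oo)%E ->
  ~ (exists c : R, forall t, fstar t = c) ->
  (forall j, ampl bstar j != 0) ->
  (\esum_(l in [set: int])
     (`|l|%:~R * normc (fourier_coef fstar l))%:E < +oo)%E ->
  ((fun n => (m n)%:R ^+ 4 / n%:R : R) @ odd_oo --> (0 : R)) ->
  [/\ bigOP P (fun n w => sup_dist (f_ n w) fstar)
        (fun n => ((m n)%:R `^ (k%:R - 2^-1))^-1 + (m n)%:R / Num.sqrt n%:R),
      exists (C : R) (M : nat), forall n, odd n -> (2 < n)%N -> (M <= m n)%N ->
        (MISE P (f_ n) fstar <=
           (C * (((m n)%:R ^+ (2 * k))^-1 + (m n)%:R / n%:R))%:E)%E
    & (fun n => (m n)%:R : R)
        ~_odd_oo (fun n => n%:R `^ ((2 * k + 1)%:R^-1)) ->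
      exists C : R, \forall n \near odd_oo,
        (MISE P (f_ n) fstar <=
           (C * n%:R `^ (- ((2 * k)%:R / (2 * k + 1)%:R)))%:E)%E].
Proof.
move=> J2 vmax0 As sigma0 [cf pf f0] hm _ _ noise Y hest f_ k0 Ck_f _ _ _ _ _.
have [B B0 hB] := shape_approx Ck_f k0 pf f0.
set us := fcos fstar in hB; set vs := fsin fstar in hB.
pose j0 : 'I_J := Ordinal (ltnW J2).
have J0 : 0 < J%:R :> R by rewrite ltr0n ltnW.
have a0 : 0 < ampl bstar j0 by have [_ [_ [_ /(_ j0 erefl) []]]] := As.
have a20 : 0 < ampl bstar j0 ^+ 2 by rewrite exprn_gt0.
pose v2 := second_moment R; have v2_ge0 : 0 <= v2 := second_moment_ge0 R.
pose K1 := 160 * J%:R * B / ampl bstar j0 ^+ 2.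
pose K2 := 320 * sigma ^+ 2 / ampl bstar j0 ^+ 2.
have K1_ge0 : 0 <= K1 by rewrite divr_ge0 ?mulr_ge0 // ltW.
have K2_ge0 : 0 <= K2.
  by apply: divr_ge0; [apply: mulr_ge0; [exact: ler0n|exact: sqr_ge0]|exact: ltW].
pose W n (w : T) := noise_energy (m n) (fun i j => @eps n i j w).
pose u n (w : T) := chat_re (Y n w) (bhat n w).
pose v n (w : T) := chat_im (Y n w) (bhat n w).
have mY n i j : measurable_fun setT (fun w => Y n w i j).
  rewrite (_ : (fun w => _) = fun w => ampl bstar j * fstar (design R i - theta bstar j)
     + level bstar j + sigma * @eps n i j w); last by apply/funext => w; rewrite mxE.
  apply: measurable_funD; first exact: measurable_cst.
  by apply: measurable_funM; [exact: measurable_cst|exact: RV_measurable].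
have mu_ n : odd n -> (2 < n)%N -> forall l, measurable_fun setT (u n ^~ l).
  by move=> on n2 l; have [mb _] := hest n on n2; exact: measurable_chat_re.
have mv_ n : odd n -> (2 < n)%N -> forall l, measurable_fun setT (v n ^~ l).
  by move=> on n2 l; have [mb _] := hest n on n2; exact: measurable_chat_im.
have mW n : measurable_fun setT (W n) by exact: measurable_noise_energy.
have W0 n w : 0 <= W n w by exact: noise_energy_ge0.
have EW n : odd n -> (2 < n)%N ->
    (\int[P]_w (W n w)%:E = (v2 * (J%:R * ((m n).+1%:R * n%:R)))%:E)%E.
  by move=> on n2; exact: expected_noise_energy (noise n on n2).
have fE n w : f_ n w = trig (m n) (u n w) (v n w).
  by apply/funext => t; rewrite /f_ fhat_trig.
have err n : odd n -> (2 < n)%N -> {ae P, forall w,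
    sqcoef (m n) (fun l => u n w l - us l) (fun l => v n w l - vs l) <=
    K1 / (m n)%:R ^+ (2 * k) + K2 / n%:R ^+ 2 * W n w}.
  move=> on n2; have [_ hmin] := hest n on n2; have [m0 mn] := hm n on n2.
  apply: filterS hmin => w hw.
  have [_ _ hd] := hB (m n) m0.
  have hd' h := hd n h (ltnW (leq_ltn_trans (leq_pmull _ (isT : 0 < 2)%N) mn)).
  exact: (coefficient_error (j0 := j0) erefl m0 mn hd' erefl As hw).
clearbody K1 K2 v2.
have risk n : odd n -> (2 < n)%N ->
  (MISE P (f_ n) fstar <= ((2 * pi * K1 + 2 * B + 4 * pi * K2 * v2 * J%:R) *
           (((m n)%:R ^+ (2 * k))^-1 + (m n)%:R / n%:R))%:E)%E.
  move=> on n2; have [m0 mn] := hm n on n2; have [hsup hint _] := hB (m n) m0.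
  have n0 : 0 < n%:R :> R by rewrite ltr0n; exact: leq_trans n2.
  have M0 : 0 < (m n)%:R :> R by rewrite ltr0n.
  set D := (m n)%:R ^+ (2 * k); have D0 : 0 < D by rewrite exprn_gt0.
  have k1_ge0 : 0 <= K1 / D by rewrite divr_ge0 // ltW.
  have k2_ge0 : 0 <= K2 / n%:R ^+ 2 by rewrite divr_ge0 ?sqr_ge0.
  have bD_ge0 : 0 <= B / D by rewrite divr_ge0 // ltW.
  have -> : MISE P (f_ n) fstar = (\int[lebesgue_measure]_(t in `[0%R, (2 * pi)%R])
     \int[P]_w (((trig (m n) (u n w) (v n w) t - fstar t) ^+ 2)%R)%:E)%E.
    rewrite /MISE; apply: eq_integral => t _; rewrite unlock.
    by apply: eq_integral => w _; rewrite fE.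
  have H := (integrated_error_le (mu_ n on n2) (mv_ n on n2) (mW n) (W0 n)
    k1_ge0 k2_ge0 bD_ge0 cf (err n on n2) hint).
  apply: (le_trans H).
  rewrite EW // -EFinM -EFinD lee_fin.
  have p0 : 0 <= pi :> R := pi_ge0 R.
  set M : R := (m n)%:R in M0 *.
  (* The frequencies [0] to [m] number [m + 1 <= 2 * m], whence [4 * pi] in the constant. *)
  have hM : 2 * pi * (K2 / n%:R ^+ 2) * (v2 * (J%:R * ((m n).+1%:R * n%:R))) <=
      4 * pi * K2 * v2 * J%:R * (M / n%:R).
    rewrite -[(m n).+1%:R]natr1 -/M.
    have -> : 2 * pi * (K2 / n%:R ^+ 2) * (v2 * (J%:R * ((M + 1) * n%:R))) =
      (2 * pi * K2 * v2 * J%:R / n%:R) * (M + 1).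
      by move: (pi : R) => p; field; rewrite gt_eqF.
    have -> : 4 * pi * K2 * v2 * J%:R * (M / n%:R) =
      (2 * pi * K2 * v2 * J%:R / n%:R) * (M + M).
      by move: (pi : R) => p; field; rewrite gt_eqF.
    apply: ler_wpM2l; last by rewrite lerD2l ler1n.
    by apply: divr_ge0; [rewrite !mulr_ge0|exact: ltW].
  have e1 : 2 * pi * (K1 / D) + 2 * (B / D) = (2 * pi * K1 + 2 * B) * D^-1.
    by move: (pi : R) => p; ring.
  rewrite e1; apply: (le_trans (lerD (lexx _) hM)).
  have x0 : 0 <= D^-1 by rewrite invr_ge0 ltW.
  have y0 : 0 <= M / n%:R by rewrite divr_ge0 // ltW.
  have c1 : 0 <= 2 * pi * K1 + 2 * B by apply: addr_ge0; rewrite !mulr_ge0.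
  have c2 : 0 <= 4 * pi * K2 * v2 * J%:R by rewrite !mulr_ge0.
  move: (2 * pi * K1 + 2 * B) (4 * pi * K2 * v2 * J%:R) c1 c2 => x y c1 c2.
  rewrite mulrDl !mulrDr [leRHS]addrACA.
  by rewrite lerD // ?lerDl ?lerDr ?mulr_ge0.
split.
- move=> e e0.
  (* Chosen so that the mean of [W n] is at most [e] times the threshold [Q * m * n]; the [+ 1]
     keeps the threshold positive, since [v2] is only known to be nonnegative. *)
  pose Q := 2 * J%:R * v2 / e + 1.
  have Q1 : 0 < Q by rewrite ltr_wpDl // divr_ge0 ?mulr_ge0 // ltW.
  (* [K ^ 2] adds the bias constants, attached to [r1 ^ 2], and the noise constant, attached to
     [r2 ^ 2]; both squares are at most [(r1 + r2) ^ 2]. *)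
  pose K : R := Num.sqrt (2 * K1 + 2 * B + 2 * K2 * Q).
  have K0 : 0 <= 2 * K1 + 2 * B + 2 * K2 * Q by rewrite !addr_ge0 ?mulr_ge0 // ltW.
  exists K => n on n2; have [m0 mn] := hm n on n2; have [hsup hint _] := hB (m n) m0.
  have n0 : 0 < n%:R :> R by rewrite ltr0n; exact: leq_trans n2.
  have M0 : 0 < (m n)%:R :> R by rewrite ltr0n.
  set D := (m n)%:R ^+ (2 * k) in hint; have D0 : 0 < D by rewrite exprn_gt0.
  have k1_ge0 : 0 <= K1 / D by rewrite divr_ge0 // ltW.
  have k2_ge0 : 0 <= K2 / n%:R ^+ 2 by rewrite divr_ge0 ?sqr_ge0.
  have bD_ge0 : 0 <= B / D by rewrite divr_ge0 // ltW.
  set r1 := ((m n)%:R `^ (k%:R - 2^-1))^-1; set r2 := (m n)%:R / Num.sqrt n%:R.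
  have r10 : 0 < r1 by rewrite invr_gt0 powR_gt0.
  have r20 : 0 < r2 by rewrite divr_gt0 ?sqrtr_gt0.
  have r1E : r1 ^+ 2 = ((m n)%:R ^+ (2 * k).-1)^-1 by exact: powR_half_sqr.
  have r2E : r2 ^+ 2 = (m n)%:R ^+ 2 / n%:R by rewrite expr_div_n sqr_sqrtr // ltW.
  have q0 : 0 < Q * ((m n)%:R * n%:R) by rewrite !mulr_gt0.
  under eq_set do rewrite fE.
  have K_ge0 : 0 <= K by exact: sqrtr_ge0.
  have r0 : 0 < r1 + r2 by rewrite addr_gt0.
  have H := @sup_dist_tail _ _ _ P _ _ _ us vs fstar (W n) _ _ _ (mu_ n on n2) (mv_ n on n2)
    (mW n) (W0 n) k2_ge0 cf (err n on n2) hsup (r1 + r2) K _ e r0 K_ge0 q0.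
  apply: H.
  + rewrite EW // lee_fin.
    have -> : Q * ((m n)%:R * n%:R) * e = (2 * J%:R * v2 + e) * (m n)%:R * n%:R.
      by rewrite /Q; field; rewrite gt_eqF.
    rewrite -[(m n).+1%:R]natr1; set M : R := (m n)%:R in M0 *.
    rewrite [leLHS](_ : _ = v2 * J%:R * (M + 1) * n%:R); last by ring.
    apply: ler_wpM2r; first exact: ltW.
    have h : v2 * J%:R <= v2 * J%:R * M.
      by apply: ler_peMr; [rewrite mulr_ge0 // ltW|rewrite ler1n].
    rewrite [leLHS](_ : _ = v2 * J%:R * M + v2 * J%:R); last by ring.
    rewrite [leRHS](_ : _ = v2 * J%:R * M + (v2 * J%:R * M + e * M)); last by ring.
    by rewrite lerD2l (le_trans h) // lerDl mulr_ge0 // ltW.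
  (* The factor [m] of [trig_sqr_le] turns [m ^- (2 * k)] into [r1 ^ 2], so estimation bias and
     uniform truncation error have the same order. *)
  have e1 : 2 * (m n)%:R * (K1 / D) = 2 * K1 * r1 ^+ 2.
    have De : D = (m n)%:R ^+ (2 * k).-1 * (m n)%:R by rewrite /D -exprSr prednK // muln_gt0.
    rewrite r1E De; set E := (m n)%:R ^+ _.
    have En0 : E != 0 by rewrite expf_neq0 // gt_eqF.
    by field; rewrite En0 gt_eqF.
  rewrite exprMn sqr_sqrtr // mulrDr e1 -r1E.
  have e2 : 2 * (m n)%:R * (K2 / n%:R ^+ 2 * (Q * ((m n)%:R * n%:R))) = 2 * K2 * Q * r2 ^+ 2.
    by rewrite r2E; field; rewrite gt_eqF.
  have h1 : r1 ^+ 2 <= (r1 + r2) ^+ 2 by rewrite lerXn2r ?nnegrE ?addr_ge0 ?lerDl // ltW.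
  have h2 : r2 ^+ 2 <= (r1 + r2) ^+ 2 by rewrite lerXn2r ?nnegrE ?addr_ge0 ?lerDr // ltW.
  rewrite e2; set x := (r1 + r2) ^+ 2 in h1 h2 *.
  rewrite (_ : _ + 2 * _ = (2 * K1 + 2 * B) * r1 ^+ 2 + 2 * K2 * Q * r2 ^+ 2); last by ring.
  rewrite [leRHS]mulrDl; apply: lerD; apply: ler_wpM2l => //.
    by rewrite addr_ge0 ?mulr_ge0.
  by rewrite !mulr_ge0 // ltW.
- by eexists; exists 0%N => n on n2 _; exact: risk.
- move=> /(balanced_rate k0) [N _ H].
  eexists; exists (maxn N 3) => // n /=; rewrite geq_max => /andP[Nn n3] on.
  apply: (le_trans (risk n on n3)); rewrite lee_fin.
  have C0 : 0 <= 2 * pi * K1 + 2 * B + 4 * pi * K2 * v2 * J%:R.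
    have p0 : 0 <= pi :> R := pi_ge0 R.
    by rewrite !addr_ge0 // !mulr_ge0.
  by apply: (le_trans (ler_wpM2l C0 (H n Nn on))); rewrite mulrA.
Qed.
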